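(* Let $p$ be a prime and let $G$ be a finite nonabelian $p$-group of coclass $2$. Then there exists an automorphism $\alpha$ of $G$ of order $p$ such that $\alpha$ is not an inner automorphism of $G$ and $\alpha(z)=z$ for every $z$ in the center $Z(G)$ of $G$.
   Context: A finite $p$-group $G$ of order $p^m$ and nilpotency class $c$ has coclass $m-c$; thus coclass $2$ means that $G$ has order $p^m$ and nilpotency class $m-2$. An automorphism of $G$ is inner if it is of the form $x\mapsto g^{-1}xg$ for some $g\in G$, and noninner otherwise. The order of an automorphism is its order as an element of $\mathrm{Aut}(G)$. *)

(* Defs.v *)
From mathcomp Require Import all_boot all_fingroup all_solvable.

Set Implicit Arguments.
Unset Strict Implicit.
Unset Printing Implicit Defensive.

Local Open Scope group_scope.

(* The coclass m - c of a p-group of order p ^ m and nilpotency class c.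
   The truncated subtraction is harmless: c <= m for every p-group. *)
Definition coclass (gT : finGroupType) (p : nat) (A : {set gT}) : nat :=
  (logn p #|A| - nil_class A)%N.

(* Recall that x ^ g is the conjugate g^-1 * x * g, and that the elements of
   Aut G are permutations of gT that are the identity outside G, so only the
   values on G matter. *)
Definition is_inner (gT : finGroupType) (G : {set gT}) (a : {perm gT}) : Prop :=
  exists2 g, g \in G & {in G, forall x, a x = x ^ g}.

(* Main.v *)
Require Import Defs.
From mathcomp Require Import all_boot all_fingroup all_solvable.
From mathcomp Require Import zify.

Set Implicit Arguments.
Unset Strict Implicit.
Unset Printing Implicit Defensive.

Local Open Scope group_scope.

(** Let c be the nilpotency class of G, so that |G| = p ^ (c + 2), and let Z be
    its centre. The proof supposes that every automorphism that fixes Z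
    pointwise and whose p-th power is 1 is inner, and reaches a contradiction.
    Every automorphism it uses extends an endomorphism of a maximal subgroup
    M >= Z by sending some x outside M to x * t with t in M ([inner_ext]). An
    automorphism that moves its arguments only by elements of 'Z_i(G) can be
    induced only by an element of 'Z_(i + 1)(G), which leaves few candidates.

    Taking the identity on M and t in Z shows that every maximal M >= Z is the
    centralizer of an element of 'Z_2(G). Since G / Z is not cyclic there are
    two such M, whence |'Z_2(G) : Z| >= p ^ 2. Coclass 2 leaves no room for
    more: if c >= 3 then |Z| = p, |'Z_i(G)| = p ^ (i + 1) for 1 < i < c, and
    F = 'Z_(c - 1)(G), of index p ^ 2, is both the centralizer of 'Z_2(G) and
    contained in every maximal subgroup above Z ([logn_ucn], [cent_ucn2]).

    Let v be a noncentral element of 'Z_2(G) of order p, M its centralizer, x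
    outside M and y in M outside F. If N <= F is normal in G of index p ^ 3 and
    contains Z and v, if G / N is not abelian and if x ^ p and y ^ p lie in N,
    then some automorphism is trivial on N and on x and sends y to y * v; it
    multiplies [~ y, x] by the central element [~ v, x] ([two_step_twist]).
    For c >= 4 and N = 'Z_(c - 2)(G), an element inducing it lies in 'Z_3(G);
    hence 'Z_3(G) cannot centralize F ([twist_large]).

    If p is odd, the identity on M and x |-> x * v also define an
    automorphism ([odd_shift]). An element h inducing it lies in 'Z_3(G) but
    not in 'Z_2(G), and centralizes M. This is absurd for c <= 3; for c >= 4
    it makes 'Z_3(G) = <[h]> 'Z_2(G) centralize F. That all p-th powers are in
    'Z_(c - 2)(G) follows from [expgp_central], applied to G / 'Z_(c - 3)(G).

    If p = 2 and c >= 4, then G / 'Z_2(G) has maximal class, hence a cyclic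
    subgroup of index 2 ([two_maxclass_cyclic]); this makes F abelian and
    gives suitable v, x and y. There remain groups of order 16 and class 2 and
    groups of order 32 and class 3, for which further automorphisms are
    written down explicitly. *)

(** * Morphisms on a group with a normal subgroup of prime index *)

Lemma prime_index_witness (gT : finGroupType) (H K : {group gT}) p :
  prime p -> #|H : K| = p -> exists2 y, y \in H & y \notin K.
Proof.
move=> p_pr iHK; apply/subsetPn; apply: contraL (prime_gt1 p_pr) => sHK.
by rewrite -iHK -leqNgt; have /eqP-> : #|H : K| == 1%N by rewrite indexg_eq1.
Qed.

Section PrimeIndex.

Variables (aT : finGroupType) (G M : {group aT}) (p : nat) (x : aT).
Hypotheses (p_pr : prime p) (nMG : M <| G) (iMG : #|G : M| = p).
Hypotheses (Gx : x \in G) (notMx : x \notin M).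

Let nMx : x \in 'N(M). Proof. exact: subsetP (normal_norm nMG) x Gx. Qed.

Lemma order_coset_prime_index : #[coset M x] = p.
Proof.
apply: nt_prime_order => //; last first.
  by apply: contra notMx => /eqP/coset_idr->.
have /eqP := erefl #|G / M|; rewrite {2}card_quotient ?normal_norm // iMG.
by move=> /eqP oGM; rewrite -oGM expg_cardG // mem_quotient.
Qed.

Lemma expg_prime_index k : (x ^+ k \in M) = (p %| k).
Proof.
rewrite -order_coset_prime_index order_dvdn -morphX //.
by apply/idP/eqP => [/coset_id|/coset_idr->] //; rewrite groupX.
Qed.

Lemma prime_index_decomp g :
  g \in G -> exists i, exists2 m, m \in M & g = x ^+ i * m.
Proof.
move=> Gg; have: coset M g \in <[coset M x]>.
  have -> : <[coset M x]> = G / M; last exact: mem_quotient.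
  apply/eqP; rewrite eqEcard cycle_subG mem_quotient //= -orderE.
  by rewrite order_coset_prime_index card_quotient ?normal_norm // iMG.
case/cycleP=> i; rewrite -morphX // => eq_c.
exists i; exists (x ^- i * g); last by rewrite mulKVg.
have nMg := subsetP (normal_norm nMG) g Gg.
rewrite coset_idr ?groupM ?groupV ?groupX //.
by rewrite morphM ?groupV ?groupX //= morphV ?groupX //= eq_c mulVg.
Qed.

Variable rT : finGroupType.

Lemma eq_morphism_prime_index (f1 f2 : aT -> rT) :
    {in G &, {morph f1 : a b / a * b}} -> {in G &, {morph f2 : a b / a * b}} ->
    {in M, f1 =1 f2} -> f1 x = f2 x ->
  {in G, f1 =1 f2}.
Proof.
move=> f1M f2M eqM eqx _ /prime_index_decomp[i [m Mm ->]].
have Gm := subsetP (normal_sub nMG) m Mm.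
have GX k := groupX k Gx.
rewrite (f1M _ _ (GX i) Gm) (f2M _ _ (GX i) Gm) (eqM _ Mm); congr (_ * _).
elim: i => [|i IHi]; first by rewrite !expg0 eqM.
by rewrite !expgS (f1M _ _ Gx (GX i)) (f2M _ _ Gx (GX i)) eqx IHi.
Qed.

Variables (f : aT -> rT) (y : rT).
Hypotheses (fM : {in M &, {morph f : a b / a * b}}).
Hypotheses (fJ : {in M, forall m, f (m ^ x) = f m ^ y}).
Hypothesis (fX : f (x ^+ p) = y ^+ p).

(** A group G = <[x]> M with M normal of index p is presented over M by the
    value of x ^+ p and by the conjugation action of x, so these are the only
    relations that the image y of x has to satisfy. The target group is
    arbitrary because the lemma also serves to build homomorphisms into an
    abelian subgroup. *)
Lemma ext_morphism_prime_index :
  exists F : aT -> rT,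
    [/\ {in G &, {morph F : a b / a * b}}, {in M, F =1 f} & F x = y].
Proof.
have memJ m k : m \in M -> m ^ (x ^+ k) \in M.
  by move=> Mm; rewrite memJ_norm ?groupX.
have fJX m k : m \in M -> f (m ^ (x ^+ k)) = f m ^ (y ^+ k).
  move=> Mm; elim: k => [|k IHk]; first by rewrite !conjg1.
  by rewrite !expgSr !conjgM fJ ?IHk ?memJ.
have f1 : f 1 = 1.
  by apply: (@mulgI _ (f 1)); rewrite mulg1 -fM ?mulg1.
have Mxp : x ^+ p \in M by rewrite expg_prime_index.
have fXX k : f (x ^+ (p * k)) = y ^+ (p * k).
  elim: k => [|k IHk]; first by rewrite muln0 !expg0.
  rewrite mulnS !expgD fM ?fX ?IHk // expgM groupX //.
(* the value y ^+ i * f m does not depend on how x ^+ i * m is written *)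
have wd i j m n : m \in M -> n \in M -> i <= j -> x ^+ i * m = x ^+ j * n ->
    y ^+ i * f m = y ^+ j * f n.
  move=> Mm Mn /subnKC <-; rewrite !expgD -!mulgA => /mulgI def_m.
  congr (_ * _).
  have: x ^+ (j - i) \in M.
    by rewrite -[_ ^+ _](mulgK n) -def_m groupM ?groupV.
  rewrite expg_prime_index => /dvdnP[k].
  rewrite mulnC => def_k; rewrite def_k in def_m *.
  by rewrite def_m fM ?fXX // expgM groupX.
pose F g := if [pick i : 'I_p | x ^- i * g \in M] is Some i
  then y ^+ i * f (x ^- i * g) else 1.
have FE i m : m \in M -> F (x ^+ i * m) = y ^+ i * f m.
  move=> Mm; rewrite /F; case: pickP => [j Mj | /(_ (Ordinal (ltn_pmod i (prime_gt0 p_pr))))].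
    have [le_ij | /ltnW le_ji] := leqP i j.
      by symmetry; apply: wd; rewrite ?mulKVg.
    by apply: wd; rewrite ?mulKVg.
  rewrite /= {2}(divn_eq i p) addnC expgD -mulgA mulKg groupM //.
  by rewrite mulnC expgM groupX.
exists F; split=> [a b /prime_index_decomp[i [m Mm ->]]|m Mm|].
- move=> /prime_index_decomp[j [n Mn ->]].
  have -> : x ^+ i * m * (x ^+ j * n) = x ^+ (i + j) * (m ^ (x ^+ j) * n).
    by rewrite expgD conjgE !mulgA !mulgK.
  have Mmj := memJ m j Mm.
  rewrite FE ?(groupM Mmj) // !FE // fM // fJX //.
  by rewrite expgD conjgE !mulgA !mulgK.
- by have := FE 0%N m Mm; rewrite !mul1g.
- by have := FE 1%N 1 (group1 M); rewrite !expg1 !mulg1 f1 mulg1.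
Qed.

End PrimeIndex.

(** * Automorphisms extending an endomorphism of a maximal subgroup *)

(** The condition a ^+ p = 1 admits the identity, which is inner, so that an
    automorphism need not be shown to be nontrivial. *)
Definition central_p_auts_inner (gT : finGroupType) (G : {group gT}) p :=
  forall a : {perm gT}, a \in Aut G -> a ^+ p = 1 ->
    {in 'Z(G), forall z, a z = z} -> is_inner G a.

Section InnerExtension.

Variables (gT : finGroupType) (G M : {group gT}) (p : nat).
Hypotheses (p_pr : prime p) (innG : central_p_auts_inner G p).
Hypotheses (nMG : M <| G) (iMG : #|G : M| = p) (sZM : 'Z(G) \subset M).
Variables (x t : gT).
Hypotheses (Gx : x \in G) (notMx : x \notin M) (Mt : t \in M).

(** The extension a of f with a x = x * t satisfies
    a ^ k (x) = x * t * f t * ... * f ^ (k - 1) (t); with iter p f = id on M, the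
    triviality of this product for k = p says that a ^+ p = 1. *)
Lemma inner_ext f :
    {in M &, {morph f : a b / a * b}} -> {in M, forall m, f m \in M} ->
    {in M, forall m, iter p f m = m} -> {in 'Z(G), forall z, f z = z} ->
    {in M, forall m, f (m ^ x) = f m ^ (x * t)} ->
    f (x ^+ p) = (x * t) ^+ p -> \prod_(i < p) iter i f t = 1 ->
  exists2 g, g \in G & {in M, forall m, f m = m ^ g} /\ x * t = x ^ g.
Proof.
move=> fM fin fp fZ fJ fX ft; have sMG := subsetP (normal_sub nMG).
have [F [FM Ff Fx]] :=
  ext_morphism_prime_index p_pr nMG iMG Gx notMx fM fJ fX.
have decG := prime_index_decomp p_pr nMG iMG Gx notMx.
have F1 : F 1 = 1 by apply: (@mulgI _ (F 1)); rewrite mulg1 -FM ?mulg1.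
have FX i : F (x ^+ i) = (x * t) ^+ i.
  elim: i => [|i IHi]; first by rewrite !expg0.
  by rewrite !expgSr FM ?IHi ?Fx // groupX.
have FG g : g \in G -> F g \in G.
  case/decG=> i [m Mm ->]; have [Gxi Gm] := (groupX i Gx, sMG m Mm).
  by rewrite FM // FX Ff // groupM ?groupX ?groupM //; apply: sMG => //; apply: fin.
have iterfM k m : m \in M -> iter k f m \in M.
  by move=> Mm; elim: k => //= k IHk; apply: fin.
have iterFf k m : m \in M -> iter k F m = iter k f m.
  by move=> Mm; elim: k => //= k ->; rewrite Ff ?iterfM.
have iterFG k g : g \in G -> iter k F g \in G.
  by move=> Gg; elim: k => //= k IHk; apply: FG.
have iterFM k : {in G &, {morph iter k F : a b / a * b}}.
  by move=> a b Ga Gb; elim: k => //= k ->; rewrite FM ?iterFG.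
have F_prod n (u : 'I_n -> gT) : (forall i, u i \in M) ->
    F (\prod_(i < n) u i) = \prod_(i < n) f (u i).
  move=> Mu; elim: n u Mu => [|n IHn] u Mu; first by rewrite !big_ord0.
  rewrite !big_ord_recl FM ?IHn ?Ff //; first exact: sMG.
  by apply: sMG; apply: group_prod => i _; apply: Mu.
have iterFx k : iter k F x = x * \prod_(i < k) iter i f t.
  elim: k => [|k IHk]; first by rewrite big_ord0 mulg1.
  have Mprod: \prod_(i < k) iter i f t \in M.
    by apply: group_prod => i _; apply: iterfM.
  rewrite big_ord_recl iterS IHk FM //; last exact: sMG.
  by rewrite Fx F_prod ?mulgA // => i; apply: iterfM.
have iterFX k i : iter k F (x ^+ i) = iter k F x ^+ i.
  elim: i => [|i IHi]; last by rewrite !expgSr iterFM ?IHi ?groupX.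
  by rewrite !expg0; elim: k => //= k ->.
have Fp g : g \in G -> iter p F g = g.
  case/decG=> i [m Mm ->]; have [Gxi Gm] := (groupX i Gx, sMG m Mm).
  by rewrite iterFM // iterFX iterFx ft mulg1 iterFf ?fp.
pose Fm := Morphism FM.
have injF : 'injm Fm.
  apply/injmP=> a b Ga Gb /= eqF; rewrite -(Fp a) // -(Fp b) //.
  by rewrite -(prednK (prime_gt0 p_pr)) !iterSr eqF.
have imF : Fm @* G = G.
  apply/morphim_fixP=> //.
  by apply/subsetP=> _ /morphimP[g _ Gg ->]; apply: FG.
pose a := aut injF imF.
have aE g : g \in G -> a g = F g by move=> Gg; rewrite /a autE.
have Aa : a \in Aut G := Aut_aut injF imF.
have [|z Zz|g Gg def_a] := innG Aa.
- apply: (eq_Aut (groupX p Aa) (group1 _)) => g Gg; rewrite permX perm1.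
  rewrite -[RHS]Fp //; elim: p => //= k ->.
  by rewrite aE ?iterFG.
- have Mz := subsetP sZM z Zz.
  by rewrite aE ?sMG ?Ff ?fZ.
exists g => //; split=> [m Mm|]; last by rewrite -def_a ?aE ?Fx.
by rewrite -def_a ?aE ?Ff ?sMG.
Qed.

(** The case f = id: here t may be any element of order dividing p of the
    centre of M with (x * t) ^+ p = x ^+ p, i.e. a value at x of a
    crossed homomorphism from G / M to that centre. *)
Lemma inner_ext_id :
    t \in 'C(M) -> t ^+ p = 1 -> (x * t) ^+ p = x ^+ p ->
  exists2 h, h \in 'C_G(M) & [~ x, h] = t.
Proof.
move=> cMt tp xtp; have nMx: x \in 'N(M) by apply: subsetP Gx; case/andP: nMG.
have [|||||||g Gg [cg def_t]] := @inner_ext id => //.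
- by move=> m _; elim: p.
- move=> m Mm; rewrite conjgM [RHS]conjgE -(centP cMt (m ^ x)) ?memJ_norm //.
  by rewrite mulKg.
- have id_t i : iter i id t = t by elim: i.
  by rewrite (eq_bigr (fun=> t)) ?prodg_const ?card_ord // => i _; apply: id_t.
exists g; last by rewrite commgEl -def_t mulKg.
rewrite inE Gg; apply/centP=> m Mm; apply/esym/commgP/conjg_fixP.
by rewrite -cg.
Qed.

End InnerExtension.

(** * Commutators modulo a normal subgroup and maximal subgroups *)

Section CentralizerMod.

Variables (gT : finGroupType) (G : {group gT}).
Implicit Types (N H : {group gT}).

(** The preimage of the centralizer of the coset of h: being a group, it
    reduces a congruence [~ h, a] = 1 modulo N to generators a of G. *)
Definition cent1_mod N h : {group gT} := (G :&: coset N @*^-1 'C[coset N h])%G.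

Lemma mem_cent1_mod N h a : N <| G -> h \in G ->
  (a \in cent1_mod N h) = (a \in G) && ([~ h, a] \in N).
Proof.
case/andP=> _ nNG Gh; rewrite in_setI; case Ga: (a \in G) => //=.
have [Nh Na] := (subsetP nNG h Gh, subsetP nNG a Ga).
apply/morphpreP/idP => [[_ /cent1P/esym/commgP]|Nha]; last first.
  split=> //; apply/cent1P/esym/commgP.
  by rewrite -morphR //= coset_id.
by rewrite -morphR //= => /eqP/coset_idr; apply; rewrite groupR.
Qed.

Lemma mem_ucnS n g :
  reflect (g \in G /\ {in G, forall a, [~ g, a] \in 'Z_n(G)})
          (g \in 'Z_n.+1(G)).
Proof.
rewrite ucnSnR inE; apply: (iffP andP) => [[Gg sgZ]|[Gg sgZ]]; split=> //.
  by move=> a Ga; rewrite (subsetP sgZ) // mem_commg ?set11.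
rewrite gen_subG; apply/subsetP=> _ /imset2P[_ a /set1P-> Ga ->].
exact: sgZ.
Qed.

Lemma mem_ucn2 g :
  reflect (g \in G /\ {in G, forall a, [~ g, a] \in 'Z(G)}) (g \in 'Z_2(G)).
Proof. by rewrite -ucn1; apply: mem_ucnS. Qed.

Lemma mem_center_comm g : g \in 'Z(G) ->
  {in G, forall a, commute a g}.
Proof. by case/centerP=> _ cg a Ga; apply/esym/cg. Qed.

End CentralizerMod.

Section PGroupTools.

Variables (gT : finGroupType) (G : {group gT}) (p : nat).
Hypothesis (pG : p.-group G).
Implicit Types (K H M : {group gT}).

Lemma logn_card_proper H K :
  p.-group K -> H \proper K -> logn p #|H| < logn p #|K|.
Proof.
move=> pK ltHK; have [eqK | ntK] := eqVneq (K : {set gT}) 1.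
  by have := proper_card ltHK; rewrite eqK cards1 ltnNge cardG_gt0.
have [p_pr _ _] := pgroup_pdiv pK ntK.
rewrite -(ltn_exp2l _ _ (prime_gt1 p_pr)) -!card_pgroup ?proper_card //.
exact: pgroupS (proper_sub ltHK) pK.
Qed.

Lemma logn_card_noncyclic K : prime p ->
  K <| G -> ~~ cyclic (G / K) -> logn p #|K| + 2 <= logn p #|G|.
Proof.
move=> p_pr nKG; rewrite -(Lagrange (normal_sub nKG)).
rewrite lognM ?cardG_gt0 // leq_add2l => ncyc; rewrite ltnNge; apply: contra ncyc.
rewrite -card_quotient ?normal_norm // => le1.
have := card_pgroup (quotient_pgroup K pG).
case: (logn _ _) le1 => [|[|//]] _ oGK; last by rewrite prime_cyclic ?oGK.
by rewrite (card1_trivg oGK) cyclic1.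
Qed.

Lemma exists_maximal_mem K g :
    K <| G -> ~~ cyclic (G / K) -> g \in G ->
  exists M : {group gT}, [/\ maximal M G, K \subset M & g \in M].
Proof.
move=> nKG ncyc Gg; have nKg := subsetP (normal_norm nKG) g Gg.
have sKgG: K <*> <[g]> \subset G by rewrite join_subG normal_sub // cycle_subG.
have [eqG | [M maxM]] := maximal_exists sKgG; last first.
  by rewrite join_subG cycle_subG => /andP[sKM Mg]; exists M.
case/negP: ncyc; rewrite -eqG quotientYidl ?cycle_subG //.
by rewrite quotient_cycle // cycle_cyclic.
Qed.

Lemma exists_two_maximal K :
    K <| G -> ~~ cyclic (G / K) ->
  exists M1 : {group gT}, exists M2 : {group gT}, exists x,
    [/\ maximal M1 G /\ K \subset M1, maximal M2 G /\ K \subset M2,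
        x \in G, x \notin M1 & x \in M2].
Proof.
move=> nKG ncyc.
have [M1 [maxM1 sKM1 _]] := exists_maximal_mem nKG ncyc (group1 G).
have /properP[_ [x Gx M1'x]] := maxgroupp maxM1.
have [M2 [maxM2 sKM2 M2x]] := exists_maximal_mem nKG ncyc Gx.
by exists M1, M2, x.
Qed.

(** G / 'Z_n.+1(G) is the central quotient of G / 'Z_n(G), so if it were
    cyclic then G / 'Z_n(G) would be abelian. *)
Lemma ucn_quotient_noncyclic n :
  'Z_n.+1(G) != G -> ~~ cyclic (G / 'Z_n.+1(G)).
Proof.
apply: contra => cycG; have nZn := normal_norm (ucn_normal n G).
have: abelian (G / 'Z_n(G)).
  apply: cyclic_center_factor_abelian; rewrite -ucn_central.
  by rewrite (isog_cyclic (third_isog (ucn_subS n G) (ucn_normal n G) (ucn_normal n.+1 G))).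
move/center_idP; rewrite -ucn_central => /quotient_inj -> //.
  exact: ucn_normalS.
exact: ucn_normal.
Qed.

End PGroupTools.

(** * The second centre when all candidate automorphisms are inner *)

Section Inner.

Variables (gT : finGroupType) (G : {group gT}) (p : nat).
Hypotheses (p_pr : prime p) (pG : p.-group G) (nabG : ~~ abelian G).
Hypothesis innG : central_p_auts_inner G p.

Implicit Types (M : {group gT}).

Lemma maximal_sub M : maximal M G -> M \subset G.
Proof. by move/maxgroupp/proper_sub. Qed.

Lemma maximal_eq_mem M (H : {group gT}) x :
  maximal M G -> M \subset H -> H \subset G -> x \in H -> x \notin M -> H :=: G.
Proof.
move=> maxM sMH sHG Hx M'x; apply/eqP; rewrite eqEproper sHG /=.
apply: contra M'x => ltHG; have [_ maxM'] := maxgroupP maxM.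
by rewrite -(maxM' H).
Qed.

Lemma central_shift M x t :
    maximal M G -> 'Z(G) \subset M -> x \in G -> x \notin M ->
    t \in 'Z(G) -> t ^+ p = 1 ->
  exists2 h, h \in 'C_G(M) & [~ x, h] = t.
Proof.
move=> maxM sZM Gx M'x Zt tp; have nMG := p_maximal_normal pG maxM.
apply: (inner_ext_id p_pr innG nMG (p_maximal_index pG maxM)) => //.
- exact: subsetP sZM t Zt.
- by apply: subsetP (centS (normal_sub nMG)) _ _; case/setIP: Zt.
- by rewrite expgMn ?tp ?mulg1 //; apply: mem_center_comm Zt x Gx.
Qed.

Lemma exists_central_order_p : exists2 t, t \in 'Z(G) & #[t] = p.
Proof.
have ntG : G :!=: 1 by apply: contra nabG => /eqP->; apply: abelian1.
have ntZ : 'Z(G) != 1 by rewrite center_nil_eq1 ?(pgroup_nil pG).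
have [_ p_dv _] := pgroup_pdiv (pgroupS (center_sub G) pG) ntZ.
by have [t Zt ot] := Cauchy p_pr p_dv; exists t.
Qed.

(** An element h of 'C_G(M) with [~ x, h] central and nontrivial commutes
    with every generator of G modulo the centre, and by maximality of M its
    centralizer is M itself. *)
Lemma exists_ucn2_cent1 M : maximal M G -> 'Z(G) \subset M ->
  exists h, [/\ h \in 'Z_2(G), h \notin 'Z(G) & 'C_G[h] = M].
Proof.
move=> maxM sZM; have [t Zt ot] := exists_central_order_p.
have /properP[sMG [x Gx M'x]] := maxgroupp maxM.
have tp : t ^+ p = 1 by rewrite -ot expg_order.
have [h /setIP[Gh cMh] def_t] := central_shift maxM sZM Gx M'x Zt tp.
have nt_t : t != 1 by rewrite -order_gt1 ot prime_gt1.
have C'x : x \notin 'C_G[h].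
  rewrite inE Gx /=; apply: contra nt_t => /cent1P cxh.
  by rewrite -def_t; apply/commgP.
have sMC : M \subset 'C_G[h] by rewrite subsetI sMG sub_cent1.
have nZG : 'Z(G) <| G := center_normal G.
exists h; split; last 1 first.
- have [// | ltMC] := eqVproper sMC; case/negP: C'x.
  have [_ maxM'] := maxgroupP maxM; apply: contraT => C'x.
  have ltCG : 'C_G[h] \proper G by apply/properP; split; [apply: subsetIl | exists x].
  by rewrite (maxM' [group of 'C_G[h]]) ?properxx // in ltMC.
- apply/mem_ucn2; split=> // a Ga.
  have: a \in cent1_mod G 'Z(G) h; last by rewrite mem_cent1_mod // => /andP[].
  have -> // : cent1_mod G 'Z(G) h :=: G.
  apply: (@maximal_eq_mem M _ x) => //; last 2 first.
  - exact: subsetIl.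
  - by rewrite mem_cent1_mod // Gx -invg_comm groupV def_t.
  apply/subsetP=> m Mm; rewrite mem_cent1_mod // (subsetP sMG) //=.
  have /commgP/eqP-> : commute h m by apply: (centP cMh).
  exact: group1.
- apply: contra C'x => Zh; rewrite inE Gx; apply/cent1P.
  exact: mem_center_comm Zh x Gx.
Qed.

Lemma center_quotient_noncyclic : ~~ cyclic (G / 'Z(G)).
Proof. by apply: contra nabG; apply: cyclic_center_factor_abelian. Qed.

Section UpperCentralPair.

Variables (M1 M2 : {group gT}) (x : gT).
Hypotheses (maxM1 : maximal M1 G) (sZM1 : 'Z(G) \subset M1).
Hypotheses (maxM2 : maximal M2 G) (sZM2 : 'Z(G) \subset M2).
Hypotheses (Gx : x \in G) (M1'x : x \notin M1) (M2x : x \in M2).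

Lemma center_proper_cent_ucn2 : 'Z(G) \proper 'C_('Z_2(G))(M1).
Proof.
have sMG := maximal_sub maxM1.
have [h [Z2h Z'h defM]] := exists_ucn2_cent1 maxM1 sZM1.
apply/properP; split; last first.
  by exists h => //; rewrite inE Z2h /= -sub_cent1 -defM subsetIr.
rewrite -ucn1 subsetI ucn_subS ucn1 /=.
by apply: subset_trans (centS sMG); apply: subsetIr.
Qed.

(** M1 and M2 are centralizers of elements of 'Z_2(G); an element whose
    centralizer is M2 cannot commute with M1. *)
Lemma cent_ucn2_proper : 'C_('Z_2(G))(M1) \proper 'Z_2(G).
Proof.
have [h [Z2h Z'h defM]] := exists_ucn2_cent1 maxM2 sZM2.
apply/properP; split; first exact: subsetIl.
exists h => //; apply: contra M1'x; rewrite inE Z2h /= -sub_cent1 => cM1h.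
have sM12: M1 \subset M2 by rewrite -defM subsetI cM1h maximal_sub.
have [_ maxM1'] := maxgroupP maxM1.
by rewrite -(maxM1' M2) //; apply: maxgroupp maxM2.
Qed.

Lemma cent_ucn2I : 'C_('Z_2(G))(M1) :&: 'C_('Z_2(G))(M2) = 'Z(G).
Proof.
have defG : M1 <*> M2 = G.
  apply: (@maximal_eq_mem M1 _ x) => //; first exact: joing_subl.
    by rewrite join_subG !maximal_sub.
  exact: subsetP (joing_subr _ _) x M2x.
rewrite -setIIr -centY defG; apply/eqP; rewrite eqEsubset.
have sZ : 'Z(G) \subset 'Z_2(G) by rewrite -ucn1 ucn_subS.
by rewrite setSI ?ucn_sub //= subsetI sZ subsetIr.
Qed.

End UpperCentralPair.

Lemma logn_center_ucn2 : logn p #|'Z(G)| + 2 <= logn p #|'Z_2(G)|.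
Proof.
have [M1 [M2 [x [[maxM1 sZM1] [maxM2 sZM2] Gx M1'x M2x]]]] :=
  exists_two_maximal (center_normal G) center_quotient_noncyclic.
have pZ2 := pgroupS (ucn_sub 2 G) pG.
have lt1 := center_proper_cent_ucn2 maxM1 sZM1.
have lt2 := cent_ucn2_proper maxM1 maxM2 sZM2 M1'x M2x.
rewrite addn2 (leq_trans _ (logn_card_proper pZ2 lt2)) // ltnS.
exact: logn_card_proper (pgroupS (subsetIl _ _) pZ2) lt1.
Qed.

End Inner.

(** * The upper central series in class at least three *)

Lemma center_sub_ucn2 (gT : finGroupType) (G : {group gT}) :
  'Z(G) \subset 'Z_2(G).
Proof. by rewrite -ucn1 ucn_subS. Qed.

Lemma ucn_proper_succ (gT : finGroupType) (G : {group gT}) n :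
  nilpotent G -> n < nil_class G -> 'Z_n(G) \proper 'Z_n.+1(G).
Proof.
move=> nilG lt_nc; rewrite properE ucn_subS; apply: contraL lt_nc => sZ.
rewrite -leqNgt; apply/ucn_nil_classP=> //.
apply/eqP; rewrite eqEsubset ucn_sub -quotient_sub1 ?normal_norm ?ucn_normal //.
rewrite subG1 -center_nil_eq1 ?quotient_nil // -ucn_central.
by rewrite -subG1 quotient_sub1 // normal_norm ?ucn_normalS.
Qed.

Section Coclass2.

Variables (gT : finGroupType) (G : {group gT}) (p : nat).
Hypotheses (p_pr : prime p) (pG : p.-group G) (nabG : ~~ abelian G).
Hypothesis innG : central_p_auts_inner G p.
Hypothesis (oG : logn p #|G| = (nil_class G + 2)%N).

Let nilG : nilpotent G := pgroup_nil pG.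

Lemma logn_center_gt0 : 0 < logn p #|'Z(G)|.
Proof.
have [t Zt ot] := exists_central_order_p p_pr pG nabG.
by rewrite logn_gt0 mem_primes p_pr cardG_gt0 -ot order_dvdG.
Qed.

Hypothesis c_gt2 : 2 < nil_class G.

Lemma logn_ucn_le i j :
  i <= j <= nil_class G -> logn p #|'Z_i(G)| + (j - i) <= logn p #|'Z_j(G)|.
Proof.
case/andP=> /subnKC <-; set k := (j - i)%N; rewrite addKn => le_c.
elim: k le_c => [|k IHk] le_c; first by rewrite !addn0.
rewrite addnS in le_c *; rewrite addnS (leq_ltn_trans (IHk (ltnW le_c))) //.
apply: logn_card_proper; first exact: pgroupS (ucn_sub _ _) pG.
exact: ucn_proper_succ.
Qed.

Lemma logn_ucn_pred : logn p #|'Z_(nil_class G).-1(G)| <= nil_class G.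
Proof.
rewrite -(leq_add2r 2) -oG; apply: (logn_card_noncyclic pG) => //.
  exact: ucn_normal.
have := c_gt2; have := ucn_nil_classP (nil_class G).-1 nilG.
case: (nil_class G) => [|[|c]] //= cP _; apply: ucn_quotient_noncyclic.
by apply/eqP => /cP; rewrite ltnn.
Qed.

(** The lower bounds |'Z(G)| >= p, |'Z_2(G)| >= p ^ 2 |'Z(G)|,
    |'Z_i.+1(G)| >= p |'Z_i(G)| and |G| >= p ^ 2 |'Z_c.-1(G)| multiply to
    p ^ (c + 2) = |G|, so each of them is an equality. *)
Lemma logn_ucn i : 1 < i < nil_class G -> logn p #|'Z_i(G)| = i.+1.
Proof.
case/andP=> i_gt1 lt_ic; have c_gt0 := leq_ltn_trans (leq0n i) lt_ic.
have le1 := logn_center_ucn2 p_pr pG nabG innG.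
have lt0 := logn_center_gt0.
have le2 : logn p #|'Z_2(G)| + (i - 2) <= logn p #|'Z_i(G)|.
  by apply: logn_ucn_le; rewrite i_gt1 ltnW.
have le3 : logn p #|'Z_i(G)| + ((nil_class G).-1 - i) <= nil_class G.
  apply: leq_trans logn_ucn_pred; apply: logn_ucn_le.
  by rewrite leq_pred andbT -ltnS prednK.
by move: lt0 le1 le2 le3; set a := logn p _; set b := logn p _; lia.
Qed.

Lemma logn_center : logn p #|'Z(G)| = 1%N.
Proof.
have le1 := logn_center_ucn2 p_pr pG nabG innG.
have lt0 := logn_center_gt0.
by move: le1; rewrite logn_ucn //; move: lt0; lia.
Qed.

Lemma card_center : #|'Z(G)| = p.
Proof. by rewrite (card_pgroup (pgroupS (center_sub G) pG)) logn_center. Qed.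

Lemma card_ucn i : 1 < i < nil_class G -> #|'Z_i(G)| = (p ^ i.+1)%N.
Proof.
by move=> /logn_ucn <-; apply: card_pgroup (pgroupS (ucn_sub _ _) pG).
Qed.

Lemma center_expgp z : z \in 'Z(G) -> z ^+ p = 1.
Proof. by rewrite -card_center; apply: expg_cardG. Qed.

Lemma ucn2_expgp u : u \in 'Z_2(G) -> u ^+ p \in 'Z(G).
Proof.
case/mem_ucn2=> Gu uZ; apply/centerP; split; first exact: groupX.
move=> a Ga; apply/commgP; have Zua := uZ a Ga.
rewrite commXg ?center_expgp //; exact: mem_center_comm Zua u Gu.
Qed.

Notation F := ('Z_(nil_class G).-1(G)).

Lemma cent_ucn2_sub_maximal (M : {group gT}) :
  maximal M G -> 'Z(G) \subset M -> 'C_G('Z_2(G)) \subset M.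
Proof.
move=> maxM sZM.
have [h [Z2h _ <-]] := exists_ucn2_cent1 p_pr pG nabG innG maxM sZM.
by rewrite setIS // -cent_set1 centS // sub1set.
Qed.

(** On the one hand F is the intersection of two maximal subgroups, and
    'C_G('Z_2(G)) is contained in every maximal subgroup above the centre. On
    the other hand, if M1 and M2 are distinct such subgroups, then 'Z_2(G) is
    generated by the elements that commute with M1 and those that commute with
    M2, so that M1 :&: M2, which has the same order as F, centralizes it. *)
Lemma cent_ucn2 : 'C_G('Z_2(G)) = F.
Proof.
have [cc c1_gt1 lt_c1] : [/\ (nil_class G).-1.+1 = nil_class G,
    1 < (nil_class G).-1 & (nil_class G).-1 < nil_class G].
  by move: c_gt2; split; lia.
have lognF : logn p #|F| = nil_class G by rewrite logn_ucn ?cc ?c1_gt1 /=.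
have sZF : 'Z(G) \subset F by rewrite -ucn1; apply: ucn_sub_geq; apply: ltnW.
have ncycF : ~~ cyclic (G / F).
  have := ucn_nil_classP (nil_class G).-1 nilG; rewrite -(prednK (ltnW c1_gt1)).
  move=> cP; apply: ucn_quotient_noncyclic; apply/eqP=> /cP.
  by rewrite prednK ?(ltnW c1_gt1) // leqNgt lt_c1.
have logn_sub (H K : {group gT}) : H \subset K -> K \subset G ->
    logn p #|K| <= logn p #|H| -> H :=: K.
  move=> sHK sKG; have [// | ltHK] := eqVproper sHK.
  by rewrite leqNgt (logn_card_proper (pgroupS sKG pG) ltHK).
have logn_max (M : {group gT}) : maximal M G -> logn p #|M| = (nil_class G).+1.
  move=> maxM; have sMG := maximal_sub maxM.
  have := oG; rewrite -(Lagrange sMG) (p_maximal_index pG maxM).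
  by rewrite lognM ?cardG_gt0 ?prime_gt0 // (logn_prime p p_pr) eqxx; lia.
have sCF : 'C_G('Z_2(G)) \subset F.
  have [M1 [M2 [x [[maxM1 sFM1] [maxM2 sFM2] Gx M1'x M2x]]]] :=
    exists_two_maximal (ucn_normal _ _) ncycF.
  have sMG := maximal_sub maxM2.
  have <- : M1 :&: M2 = F.
    symmetry; apply: logn_sub; first by rewrite subsetI sFM1.
      by rewrite subIset ?sMG ?orbT.
    rewrite lognF -ltnS -(logn_max M2) // logn_card_proper ?(pgroupS sMG) //.
    by apply/properP; split; [apply: subsetIr | exists x; rewrite // inE (negPf M1'x)].
  by rewrite subsetI !cent_ucn2_sub_maximal ?(subset_trans sZF).
apply: (logn_sub) => //; first exact: ucn_sub.
have [M1 [M2 [x [[maxM1 sZM1] [maxM2 sZM2] Gx M1'x M2x]]]] :=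
  exists_two_maximal (center_normal G) (center_quotient_noncyclic nabG).
have [sM1 sM2] := (maximal_sub maxM1, maximal_sub maxM2).
apply: (@leq_trans (logn p #|M1 :&: M2|)).
  have le_card : #|M1 * M2| <= #|G| by rewrite subset_leq_card // mul_subG.
  have := mul_cardG M1 M2; have pI := pgroupS (subset_trans (subsetIl M1 M2) sM1) pG.
  rewrite (card_pgroup (pgroupS sM1 pG)) (card_pgroup (pgroupS sM2 pG)).
  have oI : #|M1 :&: M2| = (p ^ logn p #|M1 :&: M2|)%N := card_pgroup pI.
  rewrite (logn_max M1) // (logn_max M2) // oI => eq_card.
  move: le_card; rewrite (card_pgroup pG) oG -(@leq_pmul2r (p ^ logn p #|M1 :&: M2|));
    last by rewrite expn_gt0 prime_gt0.
  rewrite -eq_card -!expnD leq_exp2l ?prime_gt1 // lognF.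
  by rewrite addnS addn2 !addSn !ltnS leq_add2l pfactorK.
apply: dvdn_leq_log => //; apply: cardSg.
rewrite subsetI subIset ?sM1 //= centsC.
pose C1 := 'C_('Z_2(G))(M1)%G; pose C2 := 'C_('Z_2(G))(M2)%G.
(* |C1| = p ^ 2 = |C2| and C1 meets C2 in 'Z(G), of index p ^ 2 in 'Z_2(G) *)
have defZ2 : C1 <*> C2 = 'Z_2(G).
  have pZ2 := pgroupS (ucn_sub 2 G) pG.
  have lognZ2 : logn p #|'Z_2(G)| = 3 by rewrite logn_ucn.
  have lognC (M N : {group gT}) y : maximal M G -> 'Z(G) \subset M -> maximal N G ->
      'Z(G) \subset N -> y \in N -> y \notin M -> logn p #|'C_('Z_2(G))(M)| = 2.
    move=> maxM sZM maxN sZN Ny M'y.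
    have lt1 := center_proper_cent_ucn2 p_pr pG nabG innG maxM sZM.
    have lt2 := cent_ucn2_proper p_pr pG nabG innG maxM maxN sZN M'y Ny.
    have := logn_card_proper (pgroupS (subsetIl _ _) pZ2) lt1.
    have := logn_card_proper pZ2 lt2; rewrite logn_center lognZ2 ltnS => le2 gt1.
    by apply/eqP; rewrite eqn_leq le2.
  have lognC1 := lognC _ _ _ maxM1 sZM1 maxM2 sZM2 M2x M1'x.
  have sCZ : C1 <*> C2 \subset 'Z_2(G) by rewrite join_subG !subsetIl.
  apply: (logn_sub) => //; first exact: ucn_sub.
  rewrite lognZ2 -lognC1; apply: logn_card_proper (pgroupS sCZ pZ2) _.
  rewrite properE joing_subl join_subG subxx /=.
  apply/negP=> sC21; have := center_proper_cent_ucn2 p_pr pG nabG innG maxM2 sZM2.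
  have := cent_ucn2I maxM1 maxM2 M1'x M2x.
  by rewrite setIC (setIidPl sC21) => ->; rewrite properxx.
rewrite -defZ2 join_subG; apply/andP; split.
  by rewrite centsC (subset_trans (subsetIl _ _)) // centsC subsetIr.
by rewrite centsC (subset_trans (subsetIr _ _)) // centsC subsetIr.
Qed.

End Coclass2.

(** * Automorphisms trivial on a subgroup of index p cubed *)

Section TwoStepTwist.

Variables (gT : finGroupType) (G M F N : {group gT}) (p : nat).
Hypotheses (p_pr : prime p) (innG : central_p_auts_inner G p).
Hypotheses (nMG : M <| G) (nFG : F <| G) (nNG : N <| G).
Hypotheses (iMG : #|G : M| = p) (iFM : #|M : F| = p) (iNF : #|F : N| = p).
Hypotheses (sFM : F \subset M) (sNF : N \subset F) (sZN : 'Z(G) \subset N).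
Hypothesis (sFGN : {in F & G, forall a b, [~ a, b] \in N}).
Variables (v x y : gT).
Hypotheses (Nv : v \in N) (cMv : v \in 'C(M)) (vp : v ^+ p = 1).
Hypotheses (Gx : x \in G) (M'x : x \notin M) (My : y \in M) (F'y : y \notin F).
Hypotheses (Nxp : x ^+ p \in N) (Nyp : y ^+ p \in N).
Hypotheses (Zvx : [~ v, x] \in 'Z(G)) (vxp : [~ v, x] ^+ p = 1).
Hypotheses (Fyx : [~ y, x] \in F) (N'yx : [~ y, x] \notin N).

(** The automorphism in question is m |-> m * chi m on M and the identity on
    x, where chi : M -> N kills N and sends [~ y, x] to [~ v, x] and y to v. It
    exists since chi commutes with the action of x: y ^ x = y * [~ y, x] is
    mapped to v * [~ v, x] = v ^ x. As chi is trivial on its own values, the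
    k-th power of the automorphism is m |-> m * chi m ^+ k. *)
Lemma two_step_twist :
  exists h, [/\ h \in G, commute x h, h \in 'C(N), [~ y, h] = v
              & [~ [~ y, x], h] = [~ v, x]].
Proof.
move: Zvx vxp Fyx N'yx; set z := [~ v, x]; set d := [~ y, x].
move=> Zz zp Fd N'd.
have [sMG sFG] := (subsetP (normal_sub nMG), subsetP (normal_sub nFG)).
have [sFM' sNF'] := (subsetP sFM, subsetP sNF).
have Gv : v \in G by apply/sFG/sNF'.
have cz a : a \in G -> a ^ z = a.
  by move=> Ga; apply/conjg_fixP/commgP; apply: mem_center_comm Zz a Ga.
have zc a : a \in G -> z ^ a = z.
  move=> Ga; apply/conjg_fixP/commgP/commute_sym.
  exact: mem_center_comm Zz a Ga.
have nNF : N <| F := normalS sNF (normal_sub nFG) nNG.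
have nFM : F <| M := normalS sFM (normal_sub nMG) nFG.
have [chi1 [chi1M chi1N chi1d]] : exists F0 : gT -> gT,
    [/\ {in F &, {morph F0 : a b / a * b}}, {in N, F0 =1 fun=> 1} & F0 d = z].
  apply: (ext_morphism_prime_index p_pr nNF iNF Fd N'd).
  - by move=> a b _ _; rewrite mulg1.
  - by move=> m _; rewrite conj1g.
  - by rewrite zp.
have chi1Z a : a \in F -> exists j, chi1 a = z ^+ j.
  case/(prime_index_decomp p_pr nNF iNF Fd N'd)=> j [n Nn ->]; exists j.
  rewrite chi1M ?(sNF' n) ?(groupX j Fd) // (chi1N n) // mulg1.
  elim: j => [|j IHj]; first by rewrite !expg0 chi1N.
  by rewrite !expgS chi1M ?groupX // chi1d IHj.
have chi1J a b : a \in F -> b \in G -> chi1 (a ^ b) = chi1 a.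
  move=> Fa Gb; have Nab := sFGN Fa Gb.
  by rewrite conjg_mulR chi1M ?(sNF' _ Nab) // (chi1N _ Nab) mulg1.
have [chi [chiM chiF chiy]] : exists F0 : gT -> gT,
    [/\ {in M &, {morph F0 : a b / a * b}}, {in F, F0 =1 chi1} & F0 y = v].
  apply: (ext_morphism_prime_index p_pr nFM iFM My F'y) => // [a Fa|].
    have [j def_a] := chi1Z a Fa.
    by rewrite chi1J ?sMG // def_a conjXg zc.
  by rewrite chi1N // vp.
have chi_yX i : chi (y ^+ i) = v ^+ i.
  elim: i => [|i IHi]; first by rewrite !expg0 chiF ?chi1N ?sNF'.
  by rewrite !expgS chiM ?groupX // chiy IHi.
have chiE m : m \in M -> exists i, exists j, chi m = v ^+ i * z ^+ j.
  case/(prime_index_decomp p_pr nFM iFM My F'y)=> i [a Fa ->]; exists i.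
  have [j def_a] := chi1Z a Fa; exists j.
  by rewrite chiM ?(groupX i My) ?(sFM' a) // chi_yX chiF ?def_a.
have chiN m : m \in M -> chi m \in N.
  move=> /chiE[i [j ->]].
  by rewrite groupM ?groupX // (subsetP sZN).
have chi_fix n : n \in N -> chi n = 1 by move=> Nn; rewrite chiF ?chi1N ?sNF'.
have chi_cent m : m \in M -> chi m \in 'C(M).
  move=> /chiE[i [j ->]]; rewrite groupM ?groupX //.
  by apply: subsetP (centS (normal_sub nMG)) _ _; case/setIP: Zz.
have chi_p m : m \in M -> chi m ^+ p = 1.
  move=> /chiE[i [j ->]]; rewrite expgMn; last first.
    apply: commuteX2; apply: mem_center_comm Zz v Gv.
  by rewrite -!expgM mulnC (mulnC j) !expgM vp zp !expg1n mulg1.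
have yx : y ^ x = y * d by rewrite /d -conjg_mulR.
have chiJ m : m \in M -> chi (m ^ x) = chi m ^ x.
  case/(prime_index_decomp p_pr nFM iFM My F'y)=> i [a Fa ->].
  have Fax : a ^ x \in F by rewrite memJ_norm ?(subsetP (normal_norm nFG)).
  have [[Md Ma] Max] := (sFM' d Fd, sFM' a Fa, sFM' _ Fax).
  have Myi := groupX i My.
  have Myix : (y ^+ i) ^ x \in M by rewrite memJ_norm ?(subsetP (normal_norm nMG)).
  rewrite conjMg (chiM _ _ Myix Max) (chiM _ _ Myi Ma) conjMg.
  rewrite (chiF a) // (chiF (a ^ x)) // chi1J //.
  have [j ->] := chi1Z a Fa; rewrite [in RHS]conjXg zc //; congr (_ * _).
  rewrite conjXg yx chi_yX conjXg (conjg_mulR v x) -/z.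
  elim: i {Myi Myix} => [|i IHi]; first by rewrite !expg0 chi_fix.
  have Myd := groupM My Md.
  by rewrite !expgS (chiM _ _ Myd (groupX i Myd)) IHi chiM // chiy chiF // chi1d.
pose f m := m * chi m.
have sNM n : n \in N -> n \in M by move/sNF'/sFM'.
have sZM := subset_trans sZN (subset_trans sNF sFM).
have [|||||||h Gh [fh xh]] :=
  @inner_ext _ G M p p_pr innG nMG iMG sZM x 1 Gx M'x (group1 M) f.
- move=> a b Ma Mb; rewrite /f chiM // -!mulgA; congr (_ * _).
  by rewrite !mulgA (centP (chi_cent a Ma)).
- by move=> m Mm; rewrite /f groupM // sNM ?chiN.
- move=> m Mm; suff iterE k : iter k f m = m * chi m ^+ k.
    by rewrite iterE chi_p ?mulg1.
  elim: k => [|k /= ->]; first by rewrite expg0 mulg1.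
  have Nk : chi m ^+ k \in N by rewrite groupX ?chiN.
  by rewrite /f (chiM _ _ Mm (sNM _ Nk)) (chi_fix _ Nk) mulg1 expgSr mulgA.
- by move=> z0 Zz0; rewrite /f chi_fix ?mulg1 // (subsetP sZN).
- by move=> m Mm; rewrite mulg1 /f chiJ // conjMg.
- by rewrite mulg1 /f chi_fix ?mulg1.
- have f1 i : iter i f 1 = 1 by elim: i => //= i ->; rewrite /f chi_fix ?mulg1.
  by rewrite big1 // => i _.
have comm_h m : m \in M -> [~ m, h] = chi m.
  by move=> Mm; rewrite commgEl -fh // mulKg.
exists h; split=> //.
- by apply/commgP/conjg_fixP; rewrite -xh mulg1.
- by apply/centP=> n Nn; apply/commute_sym/commgP; rewrite comm_h ?sNM // chi_fix.
- by rewrite comm_h.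
- by rewrite comm_h ?sFM' // chiF.
Qed.

End TwoStepTwist.

(** * Centralizers and p-th powers *)

(** The conjugacy class of v lies in the coset v *: A. *)
Lemma index_cent1_prime (gT : finGroupType) (H A : {group gT}) p v :
    prime p -> p.-group H -> #|A| = p -> ~~ (H \subset 'C[v]) ->
    {in H, forall a, [~ v, a] \in A} ->
  #|H : 'C_H[v]| = p.
Proof.
move=> p_pr pH oA ncHv vA.
have le_p : #|H : 'C_H[v]| <= p.
  rewrite index_cent1 -oA -(card_lcoset A v) subset_leq_card //.
  apply/subsetP=> _ /imsetP[a Ha ->]; rewrite mem_lcoset.
  by rewrite -commgEl vA.
have pI : p.-nat #|H : 'C_H[v]| := pnat_dvd (dvdn_indexg _ _) pH.
have [k def_k] := p_natP pI; move: le_p; rewrite def_k.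
case: k def_k => [|[|k]] def_k; rewrite ?expn1 //; last first.
  by rewrite -{2}(expn1 p) leq_exp2l ?prime_gt1.
move/eqP: def_k; rewrite indexg_eq1 subsetI subxx /=.
by rewrite (negPf ncHv).
Qed.

Lemma noncentral_cent1 (gT : finGroupType) (G : {group gT}) v :
  v \in G -> v \notin 'Z(G) -> ~~ (G \subset 'C[v]).
Proof.
move=> Gv; apply: contra => sGC; apply/centerP; split=> // a Ga.
exact/esym/cent1P/(subsetP sGC).
Qed.

Lemma mem_prime_index_gen (gT : finGroupType) (G M H : {group gT}) p x :
    prime p -> M <| G -> #|G : M| = p -> x \in G -> x \notin M ->
    M \subset H -> x \in H -> G \subset H.
Proof.
move=> p_pr nMG iMG Gx M'x sMH Hx; apply/subsetP=> g.
case/(prime_index_decomp p_pr nMG iMG Gx M'x)=> i [m Mm ->].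
by rewrite groupM ?groupX // (subsetP sMH).
Qed.

Lemma commgX_eq1 (gT : finGroupType) (G : {group gT}) (a b : gT) p :
    [~ a, b] \in 'Z(G) -> [~ a, b] ^+ p = 1 -> b \in G -> commute a (b ^+ p).
Proof.
move=> Zab abp Gb; apply/commgP; rewrite commgX ?abp //.
exact: mem_center_comm Zab b Gb.
Qed.

Section CentralSection.

Variables (gT : finGroupType) (H F : {group gT}) (p : nat).
Hypotheses (p_pr : prime p) (p_odd : odd p).
Hypotheses (sFH : F \subset H) (sZF : 'Z(H) \subset F) (iFZ : #|F : 'Z(H)| = p).
Hypothesis sFHZ : {in F & H, forall a b, [~ a, b] \in 'Z(H)}.
Hypothesis sHHF : {in H &, forall a b, [~ a, b] \in F}.
Hypothesis HpF : {in H, forall a, a ^+ p \in F}.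
Hypothesis Zp : {in 'Z(H), forall a, a ^+ p = 1}.

(** Write F = <[f]> 'Z(H). The p-th power of s commutes with s, so if s does
    not commute with f, that power, which is in F, is central. If g
    centralizes F, take x that does not commute with f. Conjugating by g the
    central element x ^+ p gives [~ x, g] ^+ p = 1, because p is odd, and
    then conjugating g ^+ p by x shows that x commutes with g ^+ p. *)
Lemma expgp_central g : g \in H -> g ^+ p \in 'Z(H).
Proof.
have nZF : 'Z(H) <| F := normalS sZF sFH (center_normal H).
have [f Ff Z'f] := prime_index_witness p_pr iFZ.
have sFH' := subsetP sFH.
have powF a s : a \in F -> a \notin 'Z(H) -> s \in H -> commute s a -> commute s f.
  move=> Fa Z'a Hs csa.
  have [i [n Zn ->]] := prime_index_decomp p_pr nZF iFZ Fa Z'a Ff.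
  by apply: commuteM (commuteX i csa) _; apply: mem_center_comm Zn s Hs.
have commp (s : gT) : commute s (s ^+ p) := commuteX p (commute_refl s).
have pow_ncent s : s \in H -> ~ commute s f -> s ^+ p \in 'Z(H).
  move=> Hs ncs; apply: contraT => Z'sp; case: ncs.
  exact: powF _ _ (HpF Hs) Z'sp Hs (commp s).
move=> Hg; apply: contraT => Z'gp.
have cgf := powF _ _ (HpF Hg) Z'gp Hg (commp g).
have cgF a : a \in F -> commute g a.
  move=> Fa; have [i [n Zn ->]] := prime_index_decomp p_pr nZF iFZ Ff Z'f Fa.
  by apply: commuteM (commuteX i cgf) _; apply: mem_center_comm Zn g Hg.
have [x Hx ncx] : exists2 x, x \in H & ~ commute x f.
  have /subsetPn[x Hx /cent1P ncx] := noncentral_cent1 (sFH' f Ff) Z'f.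
  by exists x.
have Zxp := pow_ncent x Hx ncx.
pose d := [~ x, g]; have Fd : d \in F by apply: sHHF.
have Zdx : [~ d, x] \in 'Z(H) by apply: sFHZ.
have Hd := sFH' d Fd.
have dp : d ^+ p = 1.
  apply: (@mulgI _ (x ^+ p)); rewrite mulg1.
  rewrite -[RHS](_ : (x ^+ p) ^ g = _); last first.
    by apply/conjg_fixP/commgP/commute_sym; apply: mem_center_comm Zxp g Hg.
  have [c1 c2] := (mem_center_comm Zdx Hd, mem_center_comm Zdx Hx).
  rewrite conjXg (conjg_mulR x g) -/d (expMg_Rmul _ c1 c2).
  by rewrite bin2odd // expgM (Zp Zdx) expg1n mulg1.
(* [~ g, x] is the inverse of d, which commutes with g *)
have cxgp : commute x (g ^+ p).
  apply/commute_sym/commgP/conjg_fixP; rewrite conjXg conjg_mulR.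
  rewrite -invg_comm -/d expgMn ?expgVn ?dp ?invg1 ?mulg1 //.
  by apply: commuteV; apply: cgF.
by case: ncx; apply: powF _ _ (HpF Hg) Z'gp Hx cxgp.
Qed.

End CentralSection.

(** * Class at least three: the subgroup 'Z_c.-1(G) *)

Section Coclass2Large.

Variables (gT : finGroupType) (G : {group gT}) (p : nat).
Hypotheses (p_pr : prime p) (pG : p.-group G) (nabG : ~~ abelian G).
Hypothesis innG : central_p_auts_inner G p.
Hypothesis (oG : logn p #|G| = (nil_class G + 2)%N).
Hypothesis c_gt2 : 2 < nil_class G.

Notation F := ('Z_(nil_class G).-1(G)).

Lemma index_ucn i : 1 < i -> i.+1 < nil_class G ->
  #|'Z_i.+1(G) : 'Z_i(G)| = p.
Proof.
move=> i_gt1 lt_ic; rewrite -divgS ?ucn_subS //.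
have cardZ := card_ucn p_pr pG nabG innG oG c_gt2.
have r1 : 1 < i < nil_class G by rewrite i_gt1 ltnW.
have r2 : 1 < i.+1 < nil_class G by rewrite ltnS (ltnW i_gt1).
by rewrite (cardZ _ r1) (cardZ _ r2) expnS mulnK // expn_gt0 prime_gt0.
Qed.

Lemma card_ucn_pred : #|F| = (p ^ nil_class G)%N.
Proof.
have cc : (nil_class G).-1.+1 = nil_class G by rewrite prednK // ltnW // ltnW.
have rF : 1 < (nil_class G).-1 < nil_class G by rewrite -ltnS -[X in _ && X]ltnS cc c_gt2 /=.
by rewrite (card_ucn p_pr pG nabG innG oG c_gt2 rF) cc.
Qed.

Lemma index_ucn_pred : #|G : F| = (p ^ 2)%N.
Proof.
rewrite -divgS ?ucn_sub // card_ucn_pred (card_pgroup pG) oG expnD mulKn //.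
by rewrite expn_gt0 prime_gt0.
Qed.

Lemma ucn_pred_sub_maximal (M : {group gT}) :
  maximal M G -> 'Z(G) \subset M -> F \subset M.
Proof.
move=> maxM sZM; rewrite -(cent_ucn2 p_pr pG nabG innG oG c_gt2).
exact: (cent_ucn2_sub_maximal p_pr pG nabG innG maxM sZM).
Qed.

Lemma index_maximal_ucn_pred (M : {group gT}) :
  maximal M G -> 'Z(G) \subset M -> #|M : F| = p.
Proof.
move=> maxM sZM; have := index_ucn_pred.
rewrite -(Lagrange_index (maximal_sub maxM) (ucn_pred_sub_maximal maxM sZM)).
rewrite (p_maximal_index pG maxM) mulnC => /eqP.
by rewrite -mulnn eqn_pmul2r ?prime_gt0 // => /eqP.
Qed.

Lemma index_cent1_ucn2 v : v \in 'Z_2(G) -> v \notin 'Z(G) -> #|G : 'C_G[v]| = p.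
Proof.
case/mem_ucn2=> Gv vZ Z'v; apply: (@index_cent1_prime _ G 'Z(G)%G) => //;
  last exact: noncentral_cent1.
exact: card_center p_pr pG nabG innG oG c_gt2.
Qed.

Lemma cent1_maximal v : v \in 'Z_2(G) -> v \notin 'Z(G) -> maximal 'C_G[v] G.
Proof.
move=> Z2v Z'v; apply: p_index_maximal; first exact: subsetIl.
by rewrite index_cent1_ucn2.
Qed.

Lemma center_sub_cent1 v : v \in G -> 'Z(G) \subset 'C_G[v].
Proof.
by move=> Gv; rewrite subsetI subsetIl (subset_trans (subsetIr _ _)) // -cent_set1 centS // sub1set.
Qed.

Lemma commg_ucn_pred2 a b :
  a \in F -> b \in G -> [~ a, b] \in 'Z_(nil_class G).-2(G).
Proof.
move: c_gt2; case: (nil_class G) => [|[|c]] // _ /= Fa Gb.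
by case/mem_ucnS: Fa => _; apply.
Qed.

Lemma commg_ucn_pred a b : a \in G -> b \in G -> [~ a, b] \in F.
Proof.
move=> Ga Gb; have nFG := ucn_norm (nil_class G).-1 G.
have abGF : abelian (G / F).
  apply: (p2group_abelian (quotient_pgroup _ pG)).
  by rewrite card_quotient // index_ucn_pred pfactorK.
by apply: (subsetP (der1_min nFG abGF)); rewrite derg1 mem_commg.
Qed.

(** For u in 'Z_2(G) the commutator [~ u, a ^+ p] = [~ u, a] ^+ p is trivial,
    so a ^+ p centralizes 'Z_2(G). *)
Lemma expgp_ucn_pred a : a \in G -> a ^+ p \in F.
Proof.
move=> Ga; rewrite -(cent_ucn2 p_pr pG nabG innG oG c_gt2) inE groupX //=.
apply/centP=> u /mem_ucn2[_ uZ]; have Zua := uZ a Ga; apply: commute_sym.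
by apply: commgX_eq1 (center_expgp p_pr pG nabG innG oG c_gt2 Zua) Ga.
Qed.

(** An element h inducing the automorphism of [two_step_twist] for
    N = 'Z_c.-2(G) commutes with generators of G modulo 'Z_2(G), so it is in
    'Z_3(G); but it does not commute with [~ y, x], which is in F. *)
Lemma twist_large v x y : 3 < nil_class G ->
    v \in 'Z_2(G) -> v \notin 'Z(G) -> v ^+ p = 1 ->
    x \in G -> x \notin 'C_G[v] -> x ^+ p \in 'Z_(nil_class G).-2(G) ->
    y \in 'C_G[v] -> y \notin F -> y ^+ p \in 'Z_(nil_class G).-2(G) ->
  ~~ (F \subset 'C('Z_3(G))).
Proof.
move=> c_gt3 Z2v Z'v vp Gx C'x Nxp Cy F'y Nyp; apply/negP=> cFZ3.
have maxM := cent1_maximal Z2v Z'v.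
have [Gv vZ] := mem_ucn2 _ _ Z2v.
have nMG := p_maximal_normal pG maxM; have iMG := p_maximal_index pG maxM.
have sZM := center_sub_cent1 Gv.
have sFM := ucn_pred_sub_maximal maxM sZM; have iFM := index_maximal_ucn_pred maxM sZM.
have nFG : F <| G := ucn_normal _ _.
have nFM := normalS sFM (normal_sub nMG) nFG.
have ccc : (nil_class G).-1 = (nil_class G).-2.+1 by rewrite prednK // -ltnS prednK ltnW // ltnW.
have Gy : y \in G by case/setIP: Cy.
pose N := 'Z_(nil_class G).-2(G)%G.
have genG (H : {group gT}) : F \subset H -> y \in H -> x \in H -> G \subset H.
  move=> sFH Hy Hx; apply: (mem_prime_index_gen p_pr nMG iMG Gx C'x _ Hx).
  exact: (mem_prime_index_gen p_pr nFM iFM Cy F'y sFH Hy).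
have Z_N i : i <= (nil_class G).-2 -> 'Z_i(G) \subset N.
  by move=> le_i; apply: ucn_sub_geq.
have c2_gt1 : 1 < (nil_class G).-2 by rewrite -ltnS -ccc -ltnS prednK // ltnW // ltnW.
have Fyx : [~ y, x] \in F.
  exact: commg_ucn_pred.
have N'yx : [~ y, x] \notin N.
  apply: contra F'y => Nyx; rewrite ccc; apply/mem_ucnS; split=> // a Ga.
  have nNG : N <| G := ucn_normal _ _.
  suff: a \in cent1_mod G N y by rewrite mem_cent1_mod // => /andP[].
  apply: subsetP a Ga; apply: genG.
  - apply/subsetP=> a Fa; rewrite mem_cent1_mod // (subsetP (ucn_sub _ _) a Fa) /=.
    by rewrite -invg_comm groupV commg_ucn_pred2.
  - by rewrite mem_cent1_mod // Gy /= commgg group1.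
  - by rewrite mem_cent1_mod // Gx.
have Zvx := vZ x Gx.
have vx_p := center_expgp p_pr pG nabG innG oG c_gt2 Zvx.
have iFN : #|F : N| = p by rewrite ccc; apply: index_ucn; rewrite -?ccc // prednK // ltnW // ltnW.
have sNF : N \subset F by rewrite ccc ucn_subS.
have cMv : v \in 'C('C_G[v]).
  by apply/centP=> a /setIP[_ /cent1P].
have sZN : 'Z(G) \subset N by rewrite -ucn1; apply: Z_N; apply: ltnW.
have Nv : v \in N by apply: subsetP (Z_N 2 c2_gt1) v Z2v.
have [h [Gh cxh cNh yh dh]] := @two_step_twist _ G 'C_G[v]%G F%G N p p_pr innG nMG nFG
   (ucn_normal _ _) iMG iFM iFN sFM sNF sZN commg_ucn_pred2 v x y Nv cMv vp
   Gx C'x Cy F'y Nxp Nyp Zvx vx_p Fyx N'yx.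
have Z3h : h \in 'Z_3(G).
  apply/mem_ucnS; split=> // a Ga; have nZ2G : 'Z_2(G) <| G := ucn_normal _ _.
  suff: a \in cent1_mod G 'Z_2(G) h by rewrite mem_cent1_mod // => /andP[].
  apply: subsetP a Ga; apply: genG.
  - have nNF : N <| F := normalS sNF (ucn_sub _ _) (ucn_normal _ _).
    apply: (mem_prime_index_gen p_pr nNF iFN Fyx N'yx).
      apply/subsetP=> n Nn; rewrite mem_cent1_mod // (subsetP (ucn_sub _ _) n Nn) /=.
      by rewrite (eqP (introT commgP (centP cNh n Nn))) group1.
    rewrite mem_cent1_mod // groupR //= -invg_comm groupV dh.
    exact: subsetP (center_sub_ucn2 G) _ Zvx.
  - by rewrite mem_cent1_mod // Gy -invg_comm groupV yh.
  - by rewrite mem_cent1_mod // Gx (eqP (introT commgP (commute_sym cxh))) group1.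
case/negP: C'x; rewrite inE Gx; apply/cent1P/esym/commgP; rewrite -dh.
by apply/commgP; apply: (centP (subsetP cFZ3 _ Fyx)).
Qed.

End Coclass2Large.

(** * Odd primes, class at least three *)

Section Odd.

Variables (gT : finGroupType) (G : {group gT}) (p : nat).
Hypotheses (p_pr : prime p) (p_odd : odd p) (pG : p.-group G).
Hypotheses (nabG : ~~ abelian G).

(** For p odd, a noncyclic p-group has a noncyclic normal abelian subgroup
    X. Then E = 'Ohm_1(X) is not in the cyclic centre, and the image of E in
    G / 'Z(G) meets the centre of that quotient. *)
Lemma exists_odd_ucn2_elem : cyclic 'Z(G) ->
  exists v, [/\ v \in 'Z_2(G), v \notin 'Z(G), v ^+ p = 1,
    #|G : 'C_G[v]| = p & {in G, forall a, [~ v, a] ^+ p = 1}].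
Proof.
move=> cycZ; have nilG := pgroup_nil pG.
have ncycG : ~~ cyclic G by apply: contra nabG; apply: cyclic_abelian.
have [X nXG /andP[abX ncycX]] :
    exists2 X : {group gT}, X <| G & abelian X && ~~ cyclic X.
  apply/exists_inP; apply: contraNT ncycG => /exists_inPn allX.
  have [X nXG abX | // | /and3P[/eqP p2]] := normal_rank1_structure pG.
    by apply: contraT => ncX; have := allX X nXG; rewrite abX ncX.
  by move: p_odd; rewrite p2.
have pX := pgroupS (normal_sub nXG) pG.
pose E := 'Ohm_1(X)%G; have abelE : p.-abelem E := Ohm1_abelem pX abX.
have nEG : E <| G := gFnormal_trans _ nXG.
have E'Z : ~~ (E \subset 'Z(G)).
  apply: contra ncycX => sEZ; rewrite abelian_rank1_cyclic // -rank_Ohm1.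
  by rewrite -abelian_rank1_cyclic ?(cyclicS sEZ) ?(abelem_abelian abelE).
have nZG := normal_norm (center_normal G).
have /trivgPn[vb /setIP[Evb Zvb] nt_vb] : (E / 'Z(G)) :&: 'Z(G / 'Z(G)) != 1.
  apply: meet_center_nil; rewrite ?quotient_nil ?quotient_normal //.
  by rewrite -subG1 quotient_sub1 // (subset_trans (normal_sub nEG)).
have [v Nv Ev def_v] := morphimP Evb.
have Z'v : v \notin 'Z(G) by apply: contra nt_vb => Zv; rewrite def_v /= coset_id.
have Gv := subsetP (normal_sub nEG) v Ev.
have vZ : {in G, forall a, [~ v, a] \in 'Z(G)}.
  move=> a Ga; have Na := subsetP nZG a Ga; apply: coset_idr; rewrite ?groupR //.
  rewrite morphR //=; apply/eqP/commgP; rewrite def_v /= in Zvb.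
  by case/centerP: Zvb => _; apply; apply: mem_quotient.
have Ep a : a \in E -> a ^+ p = 1.
  by case/abelemP: abelE => // _; apply.
have vEp : {in G, forall a, [~ v, a] ^+ p = 1}.
  move=> a Ga; apply: Ep; rewrite commgEl groupM ?groupV //.
  by rewrite memJ_norm // (subsetP (normal_norm nEG)).
exists v; split=> //; [exact/mem_ucn2 | exact: Ep |].
have pZ := pgroupS (center_sub G) pG.
apply: (@index_cent1_prime _ G 'Ohm_1('Z(G))%G) => //.
- apply: Ohm1_cyclic_pgroup_prime => //.
  by rewrite center_nil_eq1 //; apply: contra nabG => /eqP->; apply: abelian1.
- exact: noncentral_cent1.
move=> a Ga; rewrite /= (OhmE 1 pZ) expn1 mem_gen //.
by apply/LdivP; rewrite vZ ?vEp.
Qed.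

Hypothesis innG : central_p_auts_inner G p.

(** For p odd, (x * v) ^+ p = x ^+ p * v ^+ p * [~ v, x] ^+ 'C(p, 2) = x ^+ p. *)
Lemma odd_shift v x :
    v \in 'Z_2(G) -> v ^+ p = 1 -> #|G : 'C_G[v]| = p ->
    x \in G -> x \notin 'C_G[v] -> [~ v, x] ^+ p = 1 ->
  exists2 h, h \in 'C_G('C_G[v]) & [~ x, h] = v.
Proof.
move=> /mem_ucn2[Gv vZ] vp iCG Gx C'x vxp.
have maxC : maximal 'C_G[v] G by apply: p_index_maximal; rewrite ?subsetIl ?iCG.
have Zvx := vZ x Gx.
apply: (inner_ext_id p_pr innG (p_maximal_normal pG maxC) iCG) => //.
- exact: center_sub_cent1.
- by rewrite inE Gv; apply/cent1P.
- by apply/centP=> a /setIP[_ /cent1P].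
have [c1 c2] := (mem_center_comm Zvx Gv, mem_center_comm Zvx Gx).
rewrite (expMg_Rmul _ c1 c2) vp mulg1 bin2odd //.
by rewrite expgM vxp expg1n mulg1.
Qed.

Hypothesis (oG : logn p #|G| = (nil_class G + 2)%N).

Section LargeClass.

Hypothesis c_gt2 : 2 < nil_class G.

Notation F := ('Z_(nil_class G).-1(G)).

(** This is [expgp_central] in G / 'Z_(c - 3)(G), whose centre is of exponent
    p: it has order p, except for c = 4, where it is 'Z_2(G) / 'Z(G). *)
Lemma odd_expgp_ucn g : 3 < nil_class G -> g \in G ->
  g ^+ p \in 'Z_(nil_class G).-2(G).
Proof.
move=> c_gt3 Gg.
have [k defc] : exists k, nil_class G = k.+4.
  by case: (nil_class G) c_gt3 => [|[|[|[|k]]]] // _; exists k.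
rewrite defc /=; have defF : (nil_class G).-1 = k.+3 by rewrite defc.
pose L := 'Z_k.+1(G)%G; pose N := 'Z_k.+2(G)%G; pose F := 'Z_k.+3(G)%G.
have nLG : L <| G := ucn_normal _ _; have nLN := normal_norm nLG.
have sNF : N \subset F := ucn_subS _ _; have sLN : L \subset N := ucn_subS _ _.
have sFG : F \subset G := ucn_sub _ _.
have defZ : 'Z(G / L) = N / L by rewrite ucn_central.
have iFN : #|F : N| = p.
  by apply: (index_ucn p_pr pG nabG innG oG); rewrite ?defc.
have: (coset L g) ^+ p \in 'Z(G / L).
  apply: (@expgp_central _ (G / L)%G (F / L)%G) => //; last exact: mem_quotient.
  - exact: quotientS.
  - by rewrite defZ quotientS.
  - rewrite defZ index_quotient_eq // ?(subset_trans sFG) //.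
    by rewrite (subset_trans (subsetIr _ _)).
  - move=> _ _ /morphimP[a Na Fa ->] /morphimP[b Nb Gb ->].
    by rewrite /= -morphR // defZ mem_quotient //; case/mem_ucnS: Fa => _; apply.
  - move=> _ _ /morphimP[a Na Ga ->] /morphimP[b Nb Gb ->].
    by rewrite /= -morphR // mem_quotient // /F /= -defF (commg_ucn_pred p_pr pG nabG innG oG).
  - move=> _ /morphimP[a Na Ga ->].
    by rewrite /= -morphX // mem_quotient // /F /= -defF (expgp_ucn_pred p_pr pG nabG innG oG).
  - rewrite defZ => _ /morphimP[a La Na ->].
    rewrite /= -morphX //; apply/coset_id.
    have Ga := subsetP (ucn_sub k.+2 G) a Na.
    have [k0 | k_gt0] := posnP k.
      move: Na; rewrite /N /L k0 => Z2a.
      by rewrite /= ucn1 (ucn2_expgp p_pr pG nabG innG oG).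
    have iNL : #|N / L| = p.
      rewrite card_quotient ?(subset_trans _ nLN) ?ucn_sub //.
      by apply: (index_ucn p_pr pG nabG innG oG); rewrite ?defc.
    apply: coset_idr; first by rewrite groupX.
    by rewrite morphX //= -iNL expg_cardG ?mem_quotient.
have Ngp : g ^+ p \in 'N(L) by rewrite groupX // (subsetP nLN).
rewrite -morphX ?(subsetP nLN) // defZ => Ngp_bar.
have nLN' : L <| N := normalS sLN (ucn_sub _ _) nLG.
suff: g ^+ p \in coset L @*^-1 (N / L) by rewrite quotientGK.
exact/morphpreP.
Qed.

(** The element h induces x |-> x * v, the identity on the centralizer of v.
    As v is not central, h is not in 'Z_2(G), and as h centralizes
    'Z_2(G) it is in F; this already excludes c = 3, when F = 'Z_2(G). *)
Lemma odd_nil_class_gt2_absurd : False.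
Proof.
have cycZ : cyclic 'Z(G).
  by rewrite prime_cyclic // (card_center p_pr pG nabG innG oG).
have [v [Z2v Z'v vp iCG vGp]] := exists_odd_ucn2_elem cycZ.
have maxC := cent1_maximal p_pr pG nabG innG oG c_gt2 Z2v Z'v.
have /properP[_ [x Gx C'x]] := maxgroupp maxC.
have [h /setIP[Gh cCh] def_v] := odd_shift Z2v vp iCG Gx C'x (vGp x Gx).
have Gv : v \in G := subsetP (ucn_sub 2 G) v Z2v.
have sZC := center_sub_cent1 Gv.
have sFC := ucn_pred_sub_maximal p_pr pG nabG innG oG c_gt2 maxC sZC.
have cF := cent_ucn2 p_pr pG nabG innG oG c_gt2.
have c1_gt1 : 1 < (nil_class G).-1 by case: (nil_class G) c_gt2.
have Z2'h : h \notin 'Z_2(G).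
  apply: contra Z'v => /mem_ucn2[_ hZ].
  by rewrite -def_v -invg_comm groupV hZ.
have Fh : h \in F.
  rewrite -cF inE Gh; apply: subsetP cCh; apply: centS.
  exact: subset_trans (ucn_sub_geq _ c1_gt1) sFC.
have c_gt3 : 3 < nil_class G.
  rewrite ltn_neqAle c_gt2 andbT; apply: contra Z2'h => /eqP c3.
  by rewrite -c3 in Fh.
have Z3h : h \in 'Z_3(G).
  apply/mem_ucnS; split=> // a Ga; have nZ2G : 'Z_2(G) <| G := ucn_normal _ _.
  suff: a \in cent1_mod G 'Z_2(G) h by rewrite mem_cent1_mod // => /andP[].
  apply: subsetP a Ga; have nCG := p_maximal_normal pG maxC.
  apply: (mem_prime_index_gen p_pr nCG iCG Gx C'x).
    apply/subsetP=> a Ca; have [Ga _] := setIP Ca; rewrite mem_cent1_mod // Ga.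
    by rewrite (eqP (introT commgP (centP cCh a Ca))) group1.
  by rewrite mem_cent1_mod // Gx -invg_comm groupV def_v.
have iCF := index_maximal_ucn_pred p_pr pG nabG innG oG c_gt2 maxC sZC.
have [y Cy F'y] := prime_index_witness p_pr iCF.
have Gy : y \in G by case/setIP: Cy.
have [Nx Ny] := (odd_expgp_ucn c_gt3 Gx, odd_expgp_ucn c_gt3 Gy).
have := twist_large p_pr pG nabG innG oG c_gt2 c_gt3 Z2v Z'v vp Gx C'x Nx Cy F'y Ny.
case/negP; apply/centsP=> a Fa b Z3b.
have iZ32 := index_ucn p_pr pG nabG innG oG c_gt2 (ltnSn 1) c_gt3.
have nZ23 : 'Z_2(G) <| 'Z_3(G) := ucn_normalS _ _.
have [i [w Z2w ->]] := prime_index_decomp p_pr nZ23 iZ32 Z3h Z2'h Z3b.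
have cah : commute a h by apply/commute_sym/(centP cCh)/(subsetP sFC).
apply: commuteM (commuteX i cah) _.
by move: Fa; rewrite -cF => /setIP[_ /centP]; apply.
Qed.

End LargeClass.

End Odd.

(** * Class two *)

Section Class2.

Variables (gT : finGroupType) (G : {group gT}) (p : nat).
Hypotheses (p_pr : prime p) (pG : p.-group G) (nabG : ~~ abelian G).
Hypothesis innG : central_p_auts_inner G p.
Hypotheses (oG : logn p #|G| = 4) (clG : nil_class G = 2).

Lemma class2_comm a b : a \in G -> b \in G -> [~ a, b] \in 'Z(G).
Proof.
move=> Ga Gb; have: a \in 'Z_2(G).
  by have /ucn_nil_classP-> := eq_leq clG; rewrite ?(pgroup_nil pG).
by case/mem_ucn2=> _; apply.
Qed.

(** Otherwise h would commute with M and with itself, hence with G. *)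
Lemma cent_maximal_sub (M : {group gT}) x h t :
  maximal M G -> x \in G -> x \notin M -> h \in 'C_G(M) -> [~ x, h] = t ->
  t != 1 -> h \in M.
Proof.
move=> maxM Gx M'x /setIP[Gh cMh] def_t; apply: contraR => M'h.
have nMG := p_maximal_normal pG maxM.
rewrite -def_t; apply/commgP/cent1P.
apply: subsetP Gx; apply: (mem_prime_index_gen p_pr nMG (p_maximal_index pG maxM) Gh M'h).
  by rewrite -sub_cent1 in cMh *.
exact: cent1id.
Qed.

(** Let M be the centralizer of h, where [~ x, h] = t has order p. Then h is
    in the centre of M but not in 'Z(G), so that M, of order p ^ 3, is abelian.
    If |'Z(G)| were p, the map m |-> [~ x, m] from M to 'Z(G) would have a
    kernel of order at least p ^ 2, which is central in G. Finally
    M = <[h]> 'Z(G), so all t' of order p in 'Z(G), which are of the form [~ x, h'] with h' in M, are powers of t. *)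
Lemma class2_center : #|'Z(G)| = (p ^ 2)%N /\ cyclic 'Z(G).
Proof.
have ncycZ := center_quotient_noncyclic nabG.
have [M [maxM sZM _]] := exists_maximal_mem (center_normal G) ncycZ (group1 G).
have /properP[sMG [x Gx M'x]] := maxgroupp maxM.
have nMG := p_maximal_normal pG maxM; have iMG := p_maximal_index pG maxM.
have pM := pgroupS sMG pG; have pZ := pgroupS (center_sub G) pG.
have [t Zt ot] := exists_central_order_p p_pr pG nabG.
have tp : t ^+ p = 1 by rewrite -ot expg_order.
have nt_t : t != 1 by rewrite -order_gt1 ot prime_gt1.
have [h Ch def_t] := central_shift p_pr pG innG maxM sZM Gx M'x Zt tp.
have Mh := cent_maximal_sub maxM Gx M'x Ch def_t nt_t.
have [Gh cMh] := setIP Ch.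
have Z'h : h \notin 'Z(G).
  by apply: contra nt_t => Zh; rewrite -def_t; apply/commgP/(mem_center_comm Zh).
have oM3 : logn p #|M| = 3.
  have := oG; rewrite -(Lagrange sMG) iMG lognM ?cardG_gt0 ?prime_gt0 //.
  by rewrite (logn_prime p p_pr) eqxx addn1 => -[].
have sZZM : 'Z(G) \proper 'Z(M).
  apply/properP; split; last by exists h; rewrite // inE Mh.
  by rewrite subsetI sZM (subset_trans (subsetIr _ _)) // centS.
have lt0 := logn_center_gt0 p_pr pG nabG.
have pZM := pgroupS (center_sub M) pM.
have abM : abelian M.
  apply: cyclic_center_factor_abelian; apply: contraT.
  move/(logn_card_noncyclic pM p_pr (center_normal M)); rewrite oM3 addn2 !ltnS leqNgt.
  by rewrite (leq_ltn_trans lt0) // logn_card_proper.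
have lognZ : logn p #|'Z(G)| = 2.
  have := logn_card_noncyclic pG p_pr (center_normal G) ncycZ.
  rewrite oG -[4]/(2 + 2)%N leq_add2r => le2; apply/eqP; rewrite eqn_leq le2 /=.
  rewrite ltn_neqAle lt0 andbT; apply/eqP=> lognZ1.
  have oZ : #|'Z(G)| = p by rewrite (card_pgroup pZ) -lognZ1.
  have sCZ : 'C_M[x] \subset 'Z(G).
    apply/subsetP=> a /setIP[Ma cxa]; apply/centerP; split; first exact: subsetP sMG a Ma.
    move=> b Gb; apply/esym/cent1P; apply: subsetP Gb.
    apply: (mem_prime_index_gen p_pr nMG iMG Gx M'x).
      by rewrite sub_cent1 (subsetP abM).
    by rewrite cent1C.
  have : #|M : 'C_M[x]| <= p.
    rewrite index_cent1 -oZ -(card_lcoset 'Z(G) x) subset_leq_card //.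
    apply/subsetP=> _ /imsetP[a Ma ->]; rewrite mem_lcoset -commgEl.
    by rewrite class2_comm // (subsetP sMG).
  have := Lagrange (subsetIl M 'C[x]); rewrite (card_pgroup pM) oM3.
  have := subset_leq_card sCZ; rewrite oZ => le1 eq3 le2'.
  by have := leq_mul le1 le2'; rewrite eq3 mulnn leq_exp2l ?prime_gt1.
have oZ : #|'Z(G)| = (p ^ 2)%N by rewrite (card_pgroup pZ) lognZ.
split=> //.
have iMZ : #|M : 'Z(G)| = p.
  rewrite -divgS // oZ (card_pgroup pM) oM3 expnS mulnK // expn_gt0 prime_gt0 //.
have nZM : 'Z(G) <| M := normalS sZM sMG (center_normal G).
have sub_t z : z \in 'Z(G) -> z ^+ p = 1 -> z \in <[t]>.
  move=> Zz zp; have [-> | nt_z] := eqVneq z 1; first exact: group1.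
  have [h' Ch' def_z] := central_shift p_pr pG innG maxM sZM Gx M'x Zz zp.
  have Mh' := cent_maximal_sub maxM Gx M'x Ch' def_z nt_z.
  have [i [w Zw def_h']] := prime_index_decomp p_pr nZM iMZ Mh Z'h Mh'.
  rewrite -def_z def_h' commgMJ (eqP (introT commgP (mem_center_comm Zw Gx))) mul1g.
  have ct a : a \in G -> commute a t := fun Ga => mem_center_comm Zt Ga.
  rewrite commgX def_t ?(conjgXg) //; last exact: ct.
  have Gw : w \in G by case/setIP: Zw.
  by rewrite (conjg_fixP _) ?mem_cycle //; apply/commgP/commute_sym/commuteX/ct.
have [// | ncyc] := boolP (cyclic 'Z(G)).
have: #|'Z(G)| <= #|<[t]>|.
  apply: subset_leq_card; apply/subsetP=> z Zz; apply: sub_t => //.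
  have : #[z] %| p ^ 2 by rewrite -oZ order_dvdG.
  case/(dvdn_pfactor _ _ p_pr)=> [[|[|[|m]]]] // _ oz.
  - by apply/eqP; rewrite -order_dvdn oz dvd1n.
  - by apply/eqP; rewrite -order_dvdn oz.
  case/negP: ncyc; apply/cyclicP; exists z; apply/esym/eqP.
  by rewrite eqEcard cycle_subG Zz oZ -oz leqnn.
by rewrite oZ -orderE ot leqNgt -{1}(expn1 p) ltn_exp2l ?prime_gt1.
Qed.

(** The automorphism of [odd_shift] is not inner because v is not central,
    whereas commutators are. *)
Lemma odd_class2_absurd : odd p -> False.
Proof.
move=> p_odd; have [_ cycZ] := class2_center.
have [v [Z2v Z'v vp iCG vGp]] := exists_odd_ucn2_elem p_pr p_odd pG nabG cycZ.
have : ~~ (G \subset 'C_G[v]).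
  by rewrite -indexg_eq1 iCG neq_ltn prime_gt1 ?orbT.
case/subsetPn=> x Gx C'x.
have [h /setIP[Gh _] def_v] := odd_shift p_pr p_odd pG innG Z2v vp iCG Gx C'x (vGp x Gx).
by rewrite -def_v class2_comm in Z'v.
Qed.

End Class2.

(** * Class two, groups of order 16 *)

Section Order16.

Variables (gT : finGroupType) (G : {group gT}).
Hypotheses (pG : 2.-group G) (nabG : ~~ abelian G).
Hypothesis innG : central_p_auts_inner G 2.
Hypotheses (oG : logn 2 #|G| = 4) (clG : nil_class G = 2).

Let p_pr : prime 2 := isT.

Lemma order16_index_center (M : {group gT}) : maximal M G -> 'Z(G) \subset M ->
  #|M : 'Z(G)| = 2.
Proof.
move=> maxM sZM; have [oZ _] := class2_center p_pr pG nabG innG oG clG.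
have := Lagrange_index (maximal_sub maxM) sZM.
rewrite (p_maximal_index pG maxM) -(divgS (center_sub G)) oZ (card_pgroup pG) oG.
by rewrite -[(2 ^ 4 %/ 2 ^ 2)%N]/4; move: #|M : _| => n; clear; lia.
Qed.

Lemma order16_sqr a : a \in G -> a ^+ 2 \in 'Z(G).
Proof.
move=> Ga; have [Za | Z'a] := boolP (a \in 'Z(G)); first exact: groupX.
have [M [maxM sZM Ma]] := exists_maximal_mem (center_normal G)
  (center_quotient_noncyclic nabG) Ga.
have nZM : 'Z(G) <| M := normalS sZM (maximal_sub maxM) (center_normal G).
by rewrite (expg_prime_index p_pr nZM (order16_index_center maxM sZM) Ma Z'a).
Qed.

(** Let 'Z(G) = <[w]>, of order 4. Some noncentral r has square 1; let x not
    commute with r. The automorphism that conjugates by x on 'C_G[r] and sends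
    x to x * (r * w) has order 2, since (r * w) ^ x * (r * w) = 1, and it moves
    x by a noncentral element, whereas commutators are central. *)
Lemma order16_absurd : False.
Proof.
have [oZ /cyclicP[w defZ]] := class2_center p_pr pG nabG innG oG clG.
have ow : #[w] = 4 by rewrite orderE -defZ oZ.
have Zw : w \in 'Z(G) by rewrite defZ cycle_id.
have Gw : w \in G := subsetP (center_sub G) w Zw.
have w4 : w ^+ 4 = 1 by rewrite -ow expg_order.
have cw a : a \in G -> commute a w := fun Ga => mem_center_comm Zw Ga.
have comm2 := class2_comm pG clG.
(* elements of 'Z(G) of order at most 2 are squares *)
have sqZ z : z \in 'Z(G) -> z ^+ 2 = 1 -> z = 1 \/ z = w ^+ 2.
  rewrite defZ => /cycleP[i ->] /eqP; rewrite -expgM -order_dvdn ow => dv.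
  rewrite -(expg_mod_order w i) ow.
  have: i %% 4 = 0 \/ i %% 4 = 2 by clear -dv; lia.
  by case=> ->; [left | right].
have comm_sq a b : a \in G -> b \in G -> [~ a, b] ^+ 2 = 1.
  move=> Ga Gb; have Zab := comm2 a b Ga Gb.
  rewrite -(commgX 2 (mem_center_comm Zab Gb)); apply/eqP/commgP.
  exact: (mem_center_comm (order16_sqr Gb)).
(* if neither a nor b can be corrected by a central element, then both squares
   are odd powers of w and that of b * a is an even one *)
have [r Gr [Z'r r2]] : exists2 r, r \in G & r \notin 'Z(G) /\ r ^+ 2 = 1.
  have sq_root a j : a \in G -> a \notin 'Z(G) -> a ^+ 2 = w ^+ (2 * j) ->
      exists2 r, r \in G & r \notin 'Z(G) /\ r ^+ 2 = 1.
    move=> Ga Z'a a2; exists (a * w ^- j); first by rewrite groupM ?groupV ?groupX.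
    split; first by rewrite groupMr ?groupV ?groupX.
    rewrite expgMn; last by apply/commuteV/commuteX/cw.
    by rewrite a2 expgVn -expgM mulnC mulgV.
  have oddsq a : a \in G -> exists j, exists b : bool, a ^+ 2 = w ^+ (2 * j + b).
    move=> /order16_sqr; rewrite defZ => /cycleP[i ->].
    by exists i./2, (odd i); rewrite mul2n addnC odd_double_half.
  have [a Ga Z'a] : exists2 a, a \in G & a \notin 'Z(G).
    apply/subsetPn; apply: contra nabG => sGZ; exact: subset_trans sGZ (subsetIr _ _).
  have [b Gb nab] : exists2 b, b \in G & ~ commute a b.
    have /subsetPn[b Gb /cent1P nab] := noncentral_cent1 Ga Z'a.
    by exists b => // cab; apply: nab.
  have Z'b : b \notin 'Z(G) by apply/negP=> Zb; case: nab; exact: (mem_center_comm Zb).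
  have [i [[] a2]] := oddsq a Ga; last by apply: (sq_root a i); rewrite // a2 addn0.
  have [j [[] b2]] := oddsq b Gb; last by apply: (sq_root b j); rewrite // b2 addn0.
  have Z'ab : b * a \notin 'Z(G).
    apply/negP=> Zab; case: nab.
    have := mem_center_comm Zab Ga; rewrite /commute !mulgA => /mulIg //.
  have Zab := comm2 a b Ga Gb.
  have [k abk] : exists k, [~ a, b] = w ^+ (2 * k).
    by case: (sqZ _ Zab (comm_sq a b Ga Gb)) => ->; [exists 0 | exists 1%N].
  apply: (sq_root (b * a) (i + j + 1 + k)%N) => //; first exact: groupM.
  have [c1 c2] := (mem_center_comm Zab Ga, mem_center_comm Zab Gb).
  rewrite (expMg_Rmul 2 c1 c2).
  by rewrite a2 b2 abk binn expg1 -!expgD; congr (w ^+ _); clear; lia.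
pose C := 'C_G[r]%G.
have cwr := cw r Gr.
have iCG : #|G : C| = 2.
  apply: (@index_cent1_prime _ G [group of <[w ^+ 2]>]) => //.
  - by rewrite -orderE orderXdiv ow.
  - exact: noncentral_cent1.
  move=> a Ga; case: (sqZ _ (comm2 r a Gr Ga) (comm_sq r a Gr Ga)) => ->.
    exact: group1.
  exact: cycle_id.
have maxC : maximal C G by apply: p_index_maximal; rewrite ?subsetIl ?iCG.
have nCG := p_maximal_normal pG maxC.
have sZC : 'Z(G) \subset C := center_sub_cent1 Gr.
have /properP[sCG [x Gx C'x]] := maxgroupp maxC.
have abC : abelian C.
  apply: (@cyclic_factor_abelian _ 'Z(G)).
    by rewrite subsetI sZC (subset_trans (subsetIr _ _)) // centS.
  by rewrite prime_cyclic // card_quotient ?order16_index_center // normal_norm //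
    (normalS sZC sCG (center_normal G)).
have rx : r ^ x = r * w ^+ 2.
  rewrite conjg_mulR; congr (_ * _).
  case: (sqZ _ (comm2 r x Gr Gx) (comm_sq r x Gr Gx)) => // rx1.
  case/negP: C'x; rewrite inE Gx; apply/cent1P/esym/commgP.
  by rewrite rx1.
have wx : w ^ x = w by apply/conjg_fixP/commgP/commute_sym/cw.
have Cr : r \in C by rewrite inE Gr cent1id.
have Ct : r * w \in C by rewrite groupM // (subsetP sZC).
have CJ m : m \in C -> m ^ x \in C.
  by move=> Cm; rewrite memJ_norm // (subsetP (normal_norm nCG)).
have ttx : (r * w) ^ x * (r * w) = 1.
  rewrite conjMg rx wx.
  have -> : r * w ^+ 2 * w * (r * w) = r ^+ 2 * w ^+ 4.
    rewrite -(mulgA r) -expgSr -mulgA (mulgA _ r) -(commuteX 3 cwr).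
    by rewrite -(mulgA r) -expgSr mulgA.
  by rewrite r2 w4 mulg1.
have x2J m : m \in G -> m ^ (x ^+ 2) = m.
  move=> Gm; apply/conjg_fixP/commgP.
  exact: (mem_center_comm (order16_sqr Gx)).
have [|||||||g Gg [_ xg]] :=
    @inner_ext _ G C 2 p_pr innG nCG iCG sZC x (r * w) Gx C'x Ct (fun m => m ^ x).
- by move=> a b _ _; rewrite conjMg.
- exact: CJ.
- by move=> m Cm; rewrite /= -conjgM x2J // (subsetP sCG).
- move=> z Zz; apply/conjg_fixP/commgP/commute_sym.
  exact: (mem_center_comm Zz).
- move=> m Cm; rewrite conjgM; apply/esym/conjg_fixP/commgP.
  by apply: (centsP abC); rewrite ?CJ.
- rewrite conjXg conjgE mulKg; move: ttx; set t := r * w => ttx.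
  by rewrite [RHS]expgS expg1 -mulgA (mulgA t) (conjgC t) -(mulgA x _ t) ttx mulg1.
- by rewrite !big_ord_recl big_ord0 mulg1 /= (centsP abC _ Ct _ (CJ _ Ct)).
have: r * w \in 'Z(G).
  have -> : r * w = [~ x, g] by rewrite commgEl -xg mulKg.
  exact: comm2.
by rewrite groupMr // (negPf Z'r).
Qed.

End Order16.

(** * 2-groups of maximal class *)

(** Induction on the order. The preimage S of a cyclic subgroup <[s]> of index
    2 of H / 'Z(H) is abelian and <[s ^+ 2]>, the group of squares of S, is
    normal in H and nontrivial; so it contains the centre, which has order 2,
    and S = <[s]>. *)
Lemma two_maxclass_cyclic n (gT : finGroupType) (H : {group gT}) :
    #|H| = (2 ^ n.+3)%N -> (forall i, i <= n.+1 -> #|'Z_i(H)| = (2 ^ i)%N) ->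
  exists2 s, s \in H & #|H : <[s]>| = 2.
Proof.
have p_pr : prime 2 by [].
elim: n gT H => [|n IHn] gT H oH oZ.
  have oZ1 : #|'Z(H)| = 2 by rewrite -ucn1 oZ.
  have nabH : ~~ abelian H.
    by apply: contraTN isT => /center_idP ZH; move: oH; rewrite -ZH oZ1.
  have [s Hs s2] : exists2 s, s \in H & s ^+ 2 != 1.
    apply/exists_inP; apply: contraNT nabH => /exists_inPn sq1.
    apply/centsP=> a Ha b Hb; have inv c : c \in H -> c^-1 = c.
      move=> Hc; apply/eqP; rewrite eq_invg_mul -[c * c]/(c ^+ 2).
      by have := sq1 c Hc; rewrite negbK.
    by rewrite /commute -(inv (a * b)) ?groupM // invMg !inv.
  exists s => //; have os : #[s] %| 2 ^ 3 by rewrite -oH order_dvdG.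
  rewrite -divgS ?cycle_subG // oH -orderE.
  case/(dvdn_pfactor _ _ p_pr): os => [[|[|[|[|m]]]]] // _ os.
  - by rewrite -order_dvdn os in s2.
  - by rewrite -order_dvdn os in s2.
  - by rewrite os.
  case/negP: nabH; have -> : H :=: <[s]>; last exact: cycle_abelian.
  by apply/esym/eqP; rewrite eqEcard cycle_subG Hs oH -os leqnn.
pose Z := 'Z_1(H)%G; have oZ1 : #|Z| = 2 := oZ 1%N isT.
have nZH : Z <| H := ucn_normal 1 H; have sZH := normal_sub nZH; have nHZ := normal_norm nZH.
have [||sb Hsb iHsb] := IHn _ (H / Z)%G.
- by rewrite card_quotient // -divgS ?sZH // oH oZ1 expnS mulKn.
- move=> i le_i; rewrite -quotient_ucn_add addn1.
  rewrite card_quotient; last exact: subset_trans (ucn_sub _ _) nHZ.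
  by rewrite -divgS ?ucn_sub_geq // !oZ // expnS mulKn.
have [s Ns Hs def_sb] := morphimP Hsb.
pose S := (<[s]> <*> Z)%G.
have sSH : S \subset H by rewrite join_subG cycle_subG Hs sZH.
have iHS : #|H : S| = 2.
  have sZS : H :&: Z \subset S by rewrite subIset // joing_subr orbT.
  rewrite -(index_quotient_eq sZS sSH nHZ).
  by rewrite -iHsb /= quotientYidr ?cycle_subG // quotient_cycle // def_sb.
have oS : #|S| = (2 ^ n.+3)%N.
  have := Lagrange sSH; rewrite iHS oH (expnS _ n.+3) mulnC => /eqP.
  by rewrite eqn_pmul2l // => /eqP.
have defS : S :=: <[s]> * Z by rewrite [LHS]norm_joinEl // cycle_subG.
have cz z a : z \in Z -> a \in H -> commute a z.
  by rewrite /Z /= ucn1 => Zz Ha; apply: (mem_center_comm Zz).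
have z2 z : z \in Z -> z ^+ 2 = 1 by rewrite -oZ1; apply: expg_cardG.
pose P := <[s ^+ 2]>%G.
have nPH : P <| H.
  rewrite /normal cycle_subG groupX //=; apply/subsetP=> a Ha.
  rewrite inE -cycleJ cycle_subG conjXg.
  have: s ^ a \in S.
    have Ss : s \in S by rewrite -cycle_subG joing_subl.
    by rewrite memJ_norm // (subsetP (normal_norm (index2_normal sSH iHS))).
  rewrite defS => /mulsgP[_ z /cycleP[i ->] Zz ->].
  rewrite (expgMn 2 (cz z _ Zz (groupX i Hs))) (z2 z Zz) mulg1 -expgM mulnC expgM.
  exact: mem_cycle.
have nt_s2 : s ^+ 2 != 1.
  apply/eqP=> s2; have := mul_cardG <[s]> Z.
  rewrite -defS oS oZ1 => eq_card.
  have : #|<[s]>| <= 2 by rewrite -orderE; apply: dvdn_leq; rewrite // order_dvdn s2.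
  have : 0 < #|<[s]> :&: Z| by rewrite cardG_gt0.
  have : 2 ^ 3 <= 2 ^ n.+3 by rewrite leq_exp2l.
  move: eq_card; move: (2 ^ n.+3)%N #|<[s]>| #|<[s]> :&: Z|; clear; nia.
have nilH : nilpotent H by apply: (@pgroup_nil _ 2); rewrite /pgroup oH pnatX.
have sZs : Z \subset <[s]>.
  have sPs : P \subset <[s]> by rewrite cycle_subG mem_cycle.
  apply: subset_trans sPs; have ntI : P :&: Z != 1.
    rewrite /Z /= ucn1; apply: meet_center_nil => //; apply: contra nt_s2 => /eqP P1.
    by have := cycle_id (s ^+ 2); rewrite -/P P1 => /set1P->.
  have prZ : prime #|Z| by rewrite oZ1.
  have [// | tiZP] := prime_subgroupVti P prZ.
  by rewrite tiZP eqxx in ntI.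
exists s => //; have -> : <[s]> = S by rewrite defS mulGSid.
exact: iHS.
Qed.

(** * 2-groups of class at least four *)

Section TwoCommon.

Variables (gT : finGroupType) (G : {group gT}).
Hypotheses (pG : 2.-group G) (nabG : ~~ abelian G).
Hypothesis innG : central_p_auts_inner G 2.
Hypothesis (oG : logn 2 #|G| = (nil_class G + 2)%N).
Hypothesis c_gt2 : 2 < nil_class G.

Let p_pr : prime 2 := isT.

Notation Z2 := ('Z_2(G)).

Lemma two_center_uniq z1 z2 :
  z1 \in 'Z(G) -> z2 \in 'Z(G) -> z1 != 1 -> z2 != 1 -> z1 = z2.
Proof.
move=> Zz1 Zz2 nz1 nz2; have defZ : [set 1; z1] = 'Z(G).
  apply/eqP; rewrite eqEcard subUset !sub1set group1 Zz1 cards2 eq_sym nz1.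
  by rewrite (card_center p_pr pG nabG innG oG c_gt2).
by move: Zz2; rewrite -defZ => /set2P[/eqP|]; rewrite ?(negPf nz2).
Qed.

Lemma ucn2_commute a b : a \in Z2 -> b \in Z2 -> commute a b.
Proof.
have c1 : 1 < (nil_class G).-1 by case: (nil_class G) c_gt2.
move=> Za Zb; have := subsetP (ucn_sub_geq G c1) a Za.
by rewrite -(cent_ucn2 p_pr pG nabG innG oG c_gt2) => /setIP[_ /centP]; apply.
Qed.

(** The squares of elements of 'Z_2(G) are in the centre {1, u ^+ 2}; if w
    is not in <[u]>, then w or w * u has square 1. *)
Lemma two_ucn2_invol u : u \in Z2 -> u ^+ 2 != 1 ->
  [/\ <[u]> <| Z2, #|Z2 : <[u]>| = 2
    & exists v, [/\ v \in Z2, v \notin <[u]>, v \notin 'Z(G) & v ^+ 2 = 1]].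
Proof.
move=> Z2u u2.
have ZZ := center_expgp p_pr pG nabG innG oG c_gt2.
have Zu2 := ucn2_expgp p_pr pG nabG innG oG c_gt2 Z2u.
have ou : #[u] = 4.
  have : #[u] %| 2 ^ 2 by rewrite order_dvdn expgM ZZ.
  case/(dvdn_pfactor _ _ p_pr)=> [[|[|[|m]]]] // _ o_u.
  - by rewrite -order_dvdn o_u in u2.
  - by rewrite -order_dvdn o_u in u2.
have Z12 z : z \in 'Z(G) -> z = 1 \/ z = u ^+ 2.
  move=> Zz; have [|nz] := eqVneq z 1; [by left | right].
  exact: two_center_uniq.
have nuZ2 : <[u]> <| Z2.
  rewrite /normal cycle_subG Z2u cents_norm //.
  by apply/centsP=> a Za b /cycleP[i ->]; apply/commuteX/ucn2_commute.
have iZu : #|Z2 : <[u]>| = 2.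
  rewrite -divgS ?(normal_sub nuZ2) // -orderE ou.
  by rewrite (card_ucn p_pr pG nabG innG oG c_gt2) // c_gt2.
have [w Z2w u'w] := prime_index_witness p_pr iZu.
have Z'u v : v \notin <[u]> -> v \notin 'Z(G).
  by apply: contra => /Z12[] ->; rewrite ?group1 ?mem_cycle.
split=> //; have [w2 | w2] := Z12 _ (ucn2_expgp p_pr pG nabG innG oG c_gt2 Z2w).
  by exists w; split=> //; apply: Z'u.
have u'wu : w * u \notin <[u]> by rewrite groupMr ?cycle_id.
exists (w * u); split=> //; [exact: groupM | exact: Z'u |].
rewrite expgMn; last exact: ucn2_commute.
by rewrite w2 -expgD; apply/eqP; rewrite -order_dvdn ou.
Qed.

End TwoCommon.

Section TwoLarge.

Variables (gT : finGroupType) (G : {group gT}).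
Hypotheses (pG : 2.-group G) (nabG : ~~ abelian G).
Hypothesis innG : central_p_auts_inner G 2.
Hypothesis (oG : logn 2 #|G| = (nil_class G + 2)%N).
Hypothesis c_gt3 : 3 < nil_class G.

Let p_pr : prime 2 := isT.
Let c_gt2 : 2 < nil_class G := ltnW c_gt3.

Notation F := ('Z_(nil_class G).-1(G)).
Notation Z2 := ('Z_2(G)).

Lemma two_cyclic_mod_ucn2 :
  exists2 s, s \in G & #|G : <[s]> <*> Z2| = 2.
Proof.
have [k defc] : exists k, nil_class G = k.+4.
  by case: (nil_class G) c_gt3 => [|[|[|[|k]]]] // _; exists k.
have cardZ := card_ucn p_pr pG nabG innG oG c_gt2.
have nZG := ucn_norm 2 G.
have oZ2 : #|Z2| = 8 by rewrite cardZ // c_gt2.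
have [||sb Gsb iGsb] := @two_maxclass_cyclic k _ (G / Z2)%G.
- rewrite card_quotient // -divgS ?ucn_sub // oZ2 (card_pgroup pG) oG defc.
  by rewrite addnC -[8]/(2 ^ 3)%N -expnB.
- move=> i le_i; rewrite -quotient_ucn_add addnC.
  rewrite card_quotient ?(subset_trans (ucn_sub _ _)) //.
  rewrite -divgS ?ucn_sub_geq ?leq_addr // oZ2 cardZ ?defc //.
  by rewrite -[8]/(2 ^ 3)%N -expnB -?addSn ?addKn ?leq_addr //.
have [s Ns Gs def_sb] := morphimP Gsb; exists s => //.
have sSG : <[s]> <*> Z2 \subset G by rewrite join_subG cycle_subG Gs ucn_sub.
have sZS : G :&: Z2 \subset <[s]> <*> Z2 by rewrite subIset // joing_subr orbT.
rewrite -(index_quotient_eq sZS sSG nZG); apply: etrans iGsb => /=.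
by rewrite quotientYidr ?cycle_subG // quotient_cycle // def_sb.
Qed.

(** Let s generate a subgroup of index 2 modulo 'Z_2(G), which has order 8,
    and let g be a power of s in 'Z_3(G) outside 'Z_2(G). Then F is generated
    by s ^+ 2 and 'Z_2(G), so it is abelian. For r outside S = <[s]> 'Z_2(G)
    the element u = [~ g, r] commutes with s and is inverted by r; as it is not
    central, it has order 4. Hence there is v in 'Z_2(G) of order 2 that does
    not commute with s, and a y in 'C_G[v] outside F is not in S. Elements
    outside S have squares in 'Z_2(G), so [twist_large] applies to v, s * y
    and y. *)
Lemma two_large_absurd : False.
Proof.
have [s Gs iGS] := two_cyclic_mod_ucn2; pose S := (<[s]> <*> Z2)%G.
have cardZ := card_ucn p_pr pG nabG innG oG c_gt2.
have oZ2 : #|Z2| = 8 by rewrite cardZ // c_gt2.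
have sZ2G : Z2 \subset G := ucn_sub 2 G; have sZ2G' := subsetP sZ2G.
have nZG := ucn_norm 2 G; have nZ2G : Z2 <| G := ucn_normal 2 G.
have sSG : S \subset G by rewrite join_subG cycle_subG Gs ucn_sub.
have iGS' : #|G : S| = 2 := iGS.
have nSG : S <| G := index2_normal sSG iGS'.
have Ss : s \in S by rewrite -cycle_subG joing_subl.
have maxS : maximal S G by apply: p_index_maximal; rewrite ?iGS'.
have sZZ2 := center_sub_ucn2 G.
have sZ2S : Z2 \subset S by rewrite joing_subr.
have sZS := subset_trans sZZ2 sZ2S.
have sFS : F \subset S := ucn_pred_sub_maximal p_pr pG nabG innG oG c_gt2 maxS sZS.
have iSF : #|S : F| = 2 := index_maximal_ucn_pred p_pr pG nabG innG oG c_gt2 maxS sZS.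
have sFG : F \subset G := ucn_sub _ _; have sFG' := subsetP sFG.
have nFG : F <| G := ucn_normal _ _; have nFS := normalS sFS sSG nFG.
have [c1_gt1 c1_gt2] : 1 < (nil_class G).-1 /\ 2 < (nil_class G).-1.
  by case: (nil_class G) c_gt3 => [|[|[|]]].
have sZ2F : Z2 \subset F := ucn_sub_geq _ c1_gt1; have sZ2F' := subsetP sZ2F.
have sZ3F : 'Z_3(G) \subset F := ucn_sub_geq _ c1_gt2.
have cF := cent_ucn2 p_pr pG nabG innG oG c_gt2.
have cFZ2 a u : a \in F -> u \in Z2 -> commute a u.
  by rewrite -cF => /setIP[_ /centP cau] /cau.
have defS : S :=: <[s]> * Z2 by rewrite [LHS]norm_joinEl // cycle_subG (subsetP nZG).
have decS a : a \in S -> exists i, exists2 u, u \in Z2 & a = s ^+ i * u.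
  by rewrite defS => /mulsgP[_ u /cycleP[i ->] Zu ->]; exists i, u.
have genG (H : {group gT}) r : Z2 \subset H -> s \in H -> r \in H ->
    r \in G -> r \notin S -> G \subset H.
  move=> sZH Hs Hr Gr S'r; apply: (mem_prime_index_gen p_pr nSG iGS' Gr S'r _ Hr).
  by rewrite join_subG cycle_subG Hs.
have F's : s \notin F.
  apply: contraTN isT => Fs; have sSF : S \subset F by rewrite join_subG cycle_subG Fs.
  by move: iSF; have /eqP-> : #|S : F| == 1%N by rewrite indexg_eq1.
have sF i : (s ^+ i \in F) = (2 %| i) := expg_prime_index p_pr nFS iSF Ss F's i.
have abF a b : a \in F -> b \in F -> commute a b.
  move=> Fa Fb; have [i [u Zu def_a]] := decS a (subsetP sFS a Fa).
  have [j [w Zw def_b]] := decS b (subsetP sFS b Fb).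
  rewrite def_b; apply: commuteM; last exact: cFZ2.
  apply: commute_sym; rewrite def_a; apply: commuteM; first exact: commuteX2.
  apply: cFZ2 => //; rewrite -(mulgK w (s ^+ j)) -def_b.
  by rewrite groupM ?groupV // sZ2F'.
have iZ32 : #|'Z_3(G) : Z2| = 2 := index_ucn p_pr pG nabG innG oG c_gt2 (ltnSn 1) c_gt3.
have nZ23 : Z2 <| 'Z_3(G) := ucn_normalS _ _.
have [j Z3g Z2'g] : exists2 j, s ^+ j \in 'Z_3(G) & s ^+ j \notin Z2.
  have [g0 Z3g0 Z2'g0] := prime_index_witness p_pr iZ32.
  have [j [u Zu def_g0]] := decS g0 (subsetP sFS _ (subsetP sZ3F _ Z3g0)).
  have def_s : s ^+ j = g0 * u^-1 by rewrite def_g0 mulgK.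
  exists j; rewrite def_s; last by rewrite groupMr ?groupV.
  by rewrite groupM ?groupV // (subsetP (normal_sub nZ23)).
set g := s ^+ j in Z3g Z2'g.
have Fg : g \in F := subsetP sZ3F g Z3g; have Gg := sFG' g Fg.
have cgs : commute g s := commute_sym (commuteX j (commute_refl s)).
have nZ'G := center_normal G.
have Z'gr r : r \in G -> r \notin S -> [~ g, r] \notin 'Z(G).
  move=> Gr S'r; apply: contra Z2'g => Zgr; apply/mem_ucn2; split=> // a Ga.
  suff: a \in cent1_mod G 'Z(G) g by rewrite mem_cent1_mod // => /andP[].
  apply: subsetP a Ga; apply: (genG _ r _ _ _ Gr S'r).
  - apply/subsetP=> a Za; rewrite mem_cent1_mod // sZ2G' //=.
    by rewrite (eqP (introT commgP (cFZ2 _ _ Fg Za))) group1.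
  - by rewrite mem_cent1_mod // Gs (eqP (introT commgP cgs)) group1.
  - by rewrite mem_cent1_mod // Gr.
(* otherwise, by uniqueness of the subgroup of order 2 of the cyclic group
   S / 'Z_2(G), the coset of g is a power of that of r ^+ 2 and commutes with r *)
have sqr r : r \in G -> r \notin S -> r ^+ 2 \in Z2.
  move=> Gr S'r; apply: contraT => Z2'r2; case/negP: (Z'gr r Gr S'r).
  have Fr2 : r ^+ 2 \in F := expgp_ucn_pred p_pr pG nabG innG oG c_gt2 Gr.
  have Nr2 := subsetP nZG _ (sFG' _ Fr2).
  have Ns := subsetP nZG s Gs; have Ng := subsetP nZG g Gg.
  have cosetS a : a \in S -> coset Z2 a \in <[coset Z2 s]>.
    case/decS=> i [w Zw ->]; rewrite morphM ?groupX ?(subsetP nZG _ (sZ2G' w Zw)) //=.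
    by rewrite morphX //= (coset_id Zw) mulg1 mem_cycle.
  have og : #[coset Z2 g] = 2.
    apply: nt_prime_order => //; last by apply: contra Z2'g => /eqP/coset_idr->.
    by rewrite -morphX //= coset_id // (expg_prime_index p_pr nZ23 iZ32 Z3g Z2'g).
  have dv2 : 2 %| #[coset Z2 (r ^+ 2)].
    have p2 : 2.-elt (coset Z2 (r ^+ 2)).
      by apply: mem_p_elt (quotient_pgroup Z2 pG) _; rewrite mem_quotient ?groupX.
    have nt : <[coset Z2 (r ^+ 2)]> != 1.
      by rewrite cycle_eq1; apply: contra Z2'r2 => /eqP/coset_idr->.
    by have [_ dv _] := pgroup_pdiv p2 nt.
  have: <[coset Z2 g]> \subset <[coset Z2 (r ^+ 2)]>.
    rewrite -(cardSg_cyclic (cycle_cyclic (coset Z2 s))) ?cycle_subG ?cosetS //.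
    - by rewrite -!orderE og.
    - exact: subsetP sFS g Fg.
    - exact: subsetP sFS _ Fr2.
  rewrite cycle_subG => /cycleP[k def_g].
  have Z2w : (r ^+ 2) ^- k * g \in Z2.
    have Nk : (r ^+ 2) ^+ k \in 'N(Z2) := groupX k Nr2.
    apply: coset_idr; first by rewrite groupM // groupV.
    by rewrite morphM ?groupV // morphV // morphX //= def_g mulVg.
  rewrite -(mulKVg ((r ^+ 2) ^+ k) g) commMgJ.
  have /commgP/eqP-> : commute ((r ^+ 2) ^+ k) r.
    exact: commute_sym (commuteX k (commuteX 2 (commute_refl r))).
  by rewrite conj1g mul1g; case/mem_ucn2: Z2w => _; apply.
case/properP: (maxgroupp maxS) => _ [r Gr S'r].
pose u := [~ g, r].
have Z2u : u \in Z2 by case/mem_ucnS: Z3g => _; apply.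
have Z'u : u \notin 'Z(G) := Z'gr r Gr S'r.
have Fu := sZ2F' u Z2u.
have Fr2 : r ^+ 2 \in F := expgp_ucn_pred p_pr pG nabG innG oG c_gt2 Gr.
have ur : u ^ r = u^-1.
  apply: (@mulgI _ u); rewrite mulgV /u -commgMJ.
  by apply/eqP/commgP; apply: abF.
(* s conjugates r to r * [~ r, s], and [~ r, s] is in the abelian group F *)
have us : u ^ s = u.
  have Frs := commg_ucn_pred p_pr pG nabG innG oG c_gt2 Gr Gs.
  rewrite {1}/u conjRg (conjg_fixP (introT commgP cgs)) (conjg_mulR r s) commgMJ.
  rewrite (eqP (introT commgP (abF _ _ Fg Frs))) mul1g.
  by apply/conjg_fixP/commgP/abF.
have u2 : u ^+ 2 != 1.
  apply: contra Z'u => u2; have Vu : u^-1 = u by apply/eqP; rewrite eq_invg_mul.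
  apply/centerP; split=> [|a Ga]; first exact: sZ2G'.
  apply/cent1P; rewrite cent1C; apply: subsetP a Ga; apply: (genG _ r _ _ _ Gr S'r).
  - by apply/subsetP=> a Za; apply/cent1P/abF; [exact: sZ2F'|].
  - by apply/cent1P/commute_sym/commgP/conjg_fixP.
  - by apply/cent1P/commute_sym/commgP/conjg_fixP; rewrite ur.
have [nuZ2 iZu [v [Z2v u'v Z'v v2]]] := two_ucn2_invol pG nabG innG oG c_gt2 Z2u u2.
have Gv := sZ2G' v Z2v; have Fv := sZ2F' v Z2v.
have C's : s \notin 'C[v].
  apply: contra F's => Csv; rewrite -cF inE Gs -sub_cent1.
  apply: (mem_prime_index_gen p_pr nuZ2 iZu Z2v u'v); last by rewrite cent1C.
  by rewrite cycle_subG; apply/cent1P/commgP/conjg_fixP.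
have maxC := cent1_maximal p_pr pG nabG innG oG c_gt2 Z2v Z'v.
have sZC := center_sub_cent1 Gv.
have iCF := index_maximal_ucn_pred p_pr pG nabG innG oG c_gt2 maxC sZC.
have [y Cy F'y] := prime_index_witness p_pr iCF.
have [Gy cvy] := setIP Cy.
have S'y : y \notin S.
  apply/negP=> Sy; have [i [w Zw def_y]] := decS y Sy.
  have Csi : s ^+ i \in 'C[v].
    rewrite -(mulgK w (s ^+ i)) -def_y groupM ?groupV //.
    by apply/cent1P/abF => //; apply: sZ2F'.
  have F'si : ~~ (2 %| i).
    by rewrite -sF; apply: contra F'y => Fsi; rewrite def_y groupM // sZ2F'.
  case/negP: C's; have si1 : s ^+ (i %/ 2 * 2) \in 'C[v].
    by apply/cent1P/abF => //; rewrite sF dvdn_mull.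
  move: Csi; rewrite (divn_eq i 2) modn2 -[odd i]negbK -dvdn2 F'si.
  by rewrite expgD groupMl.
have C'x : s * y \notin 'C_G[v].
  by rewrite inE [_ \in 'C[v]]groupMr // (negPf C's) andbF.
have S'x : s * y \notin S by rewrite groupMl.
have Gx : s * y \in G by rewrite groupM.
have sZ2N : Z2 \subset 'Z_(nil_class G).-2(G).
  by apply: ucn_sub_geq; case: (nil_class G) c_gt3 => [|[|[|[|]]]].
have Nx := subsetP sZ2N _ (sqr _ Gx S'x); have Ny := subsetP sZ2N _ (sqr _ Gy S'y).
have := twist_large p_pr pG nabG innG oG c_gt2 c_gt3 Z2v Z'v v2 Gx C'x Nx Cy F'y Ny.
case/negP; apply/centsP=> a Fa b Z3b; apply: abF => //.
exact: subsetP sZ3F b Z3b.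
Qed.

End TwoLarge.

(** * Groups of order 32 and class three *)

Lemma mulg_index2 (gT : finGroupType) (H K : {group gT}) a b :
    K <| H -> #|H : K| = 2 -> a \in H -> b \in H -> a \notin K -> b \notin K ->
  a * b \in K.
Proof.
move=> nKH iHK Ha Hb K'a K'b; have p_pr : prime 2 by [].
have [i [m Km def_b]] := prime_index_decomp p_pr nKH iHK Ha K'a Hb.
rewrite def_b mulgA -expgS groupMr // (expg_prime_index p_pr nKH iHK Ha K'a).
rewrite dvdn2 /= negbK; apply: contraR K'b => even_i.
by rewrite def_b groupMr // (expg_prime_index p_pr nKH iHK Ha K'a) dvdn2.
Qed.

Section Order32.

Variables (gT : finGroupType) (G : {group gT}).
Hypotheses (pG : 2.-group G) (nabG : ~~ abelian G).
Hypothesis innG : central_p_auts_inner G 2.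
Hypotheses (oG : logn 2 #|G| = (nil_class G + 2)%N) (clG : nil_class G = 3).

Let p_pr : prime 2 := isT.
Let c_gt2 : 2 < nil_class G. Proof. by rewrite clG. Qed.

Notation F := ('Z_2(G)).

Let ZZ : {in 'Z(G), forall z, z ^+ 2 = 1}.
Proof. by move=> z; apply: (center_expgp p_pr pG nabG innG oG c_gt2). Qed.
Let Zuniq := two_center_uniq pG nabG innG oG c_gt2.
Let abF := ucn2_commute pG nabG innG oG c_gt2.
Let sFG : F \subset G := ucn_sub 2 G.
Let nFG : F <| G := ucn_normal 2 G.
Let sZF : 'Z(G) \subset F := center_sub_ucn2 G.

Let cF : 'C_G(F) = F.
Proof. by have := cent_ucn2 p_pr pG nabG innG oG c_gt2; rewrite clG. Qed.

Let iMF (M : {group gT}) : maximal M G -> 'Z(G) \subset M -> #|M : F| = 2.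
Proof. by have := @index_maximal_ucn_pred _ G 2 p_pr pG nabG innG oG c_gt2 M; rewrite clG. Qed.

Let sFM (M : {group gT}) : maximal M G -> 'Z(G) \subset M -> F \subset M.
Proof. by have := @ucn_pred_sub_maximal _ G 2 p_pr pG nabG innG oG c_gt2 M; rewrite clG. Qed.

Let commF a b : a \in G -> b \in G -> [~ a, b] \in F.
Proof. by have := @commg_ucn_pred _ G 2 p_pr pG nabG innG oG c_gt2 a b; rewrite clG. Qed.

Let sqrF a : a \in G -> a ^+ 2 \in F.
Proof. by have := @expgp_ucn_pred _ G 2 p_pr pG nabG innG oG c_gt2 a; rewrite clG. Qed.

Let FZ a b : a \in F -> b \in G -> [~ a, b] \in 'Z(G).
Proof. by case/mem_ucn2=> _ aZ; apply: aZ. Qed.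

Let Zfix z a : z \in 'Z(G) -> a \in G -> z ^ a = z.
Proof.
move=> Zz Ga; apply/conjg_fixP/commgP/commute_sym.
by apply: (mem_center_comm Zz).
Qed.

Let Ffix a b : a \in F -> b \in F -> a ^ b = a.
Proof. by move=> Fa Fb; apply/conjg_fixP/commgP/abF. Qed.

Let FJ a b : a \in F -> b \in G -> a ^ b \in F.
Proof. by move=> Fa Gb; rewrite memJ_norm // (subsetP (normal_norm nFG)). Qed.

(** Let h1 and h2 be elements of 'Z_2(G) with distinct centralizers M1 and
    M2, x in M1 outside M2 and y in M2 outside M1. The automorphism is trivial
    on 'Z_2(G) and sends x to x * h1 and y to y * h2. It respects [~ y, x]
    because [~ y, h1] and [~ h2, x] are both the generator of the centre. An
    element inducing it centralizes 'Z_2(G), so lies in it, but h1 is not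
    central. *)
Lemma order32_elementary_absurd : ~ {in F, forall u, u ^+ 2 = 1}.
Proof.
move=> F2; have sFG' := subsetP sFG.
have [M1 [M2 [y [[maxM1 sZM1] [maxM2 sZM2] Gy M1'y M2y]]]] :=
  exists_two_maximal (center_normal G) (center_quotient_noncyclic nabG).
have [h1 [Fh1 Z'h1 defM1]] := exists_ucn2_cent1 p_pr pG nabG innG maxM1 sZM1.
have [h2 [Fh2 Z'h2 defM2]] := exists_ucn2_cent1 p_pr pG nabG innG maxM2 sZM2.
have [x M1x M2'x] : exists2 x, x \in M1 & x \notin M2.
  apply/subsetPn; apply: contra M1'y => sM12.
  have [_ maxM] := maxgroupP maxM1.
  by rewrite -(maxM M2) //; apply: maxgroupp maxM2.
have sM2G := maximal_sub maxM2; have sM2G' := subsetP sM2G.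
have Gx : x \in G := subsetP (maximal_sub maxM1) x M1x.
have nMG := p_maximal_normal pG maxM2; have iMG := p_maximal_index pG maxM2.
have sFM2 := sFM maxM2 sZM2; have sFM2' := subsetP sFM2.
have nFM := normalS sFM2 sM2G nFG; have iFM := iMF maxM2 sZM2.
have F'y : y \notin F by apply: contra M1'y; apply: subsetP (sFM maxM1 sZM1) y.
have ch1x : commute x h1 by move: M1x; rewrite -defM1 => /setIP[_ /cent1P].
have cM2h2 m : m \in M2 -> commute m h2.
  by rewrite -defM2 => /setIP[_ /cent1P].
have decM := prime_index_decomp p_pr nFM iFM M2y F'y.
have [chi [chiM chiF chiy]] : exists F0 : gT -> gT,
    [/\ {in M2 &, {morph F0 : a b / a * b}}, {in F, F0 =1 fun=> 1} & F0 y = h2].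
  apply: (ext_morphism_prime_index p_pr nFM iFM M2y F'y).
  - by move=> a b _ _; rewrite mulg1.
  - by move=> a _; rewrite conj1g.
  - by rewrite F2.
have chiE m : m \in M2 -> exists i, chi m = h2 ^+ i.
  case/decM=> i [a Fa ->]; exists i.
  rewrite (chiM _ _ (groupX i M2y) (sFM2' a Fa)) (chiF _ Fa) mulg1.
  elim: i => [|i IHi]; first by rewrite !expg0 chiF.
  by rewrite !expgS chiM ?groupX // chiy IHi.
have Fchi m : m \in M2 -> chi m \in F by case/chiE=> i ->; rewrite groupX.
pose f m := m * chi m.
have fM : {in M2 &, {morph f : a b / a * b}}.
  move=> a b Ma Mb; rewrite /f chiM // -!mulgA; congr (_ * _).
  have [i ->] := chiE a Ma; rewrite !mulgA; congr (_ * _).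
  exact: commuteX i (cM2h2 b Mb).
have [z1 z2] : [~ y, h1] != 1 /\ [~ h2, x] != 1.
  split; apply/negP => /commgP cab.
    by case/negP: M1'y; rewrite -defM1 inE Gy; apply/cent1P.
  by case/negP: M2'x; rewrite -defM2 inE Gx; apply/cent1P/commute_sym.
have Gh1 := sFG' _ Fh1; have Gh2 := sFG' _ Fh2.
have z12 : [~ h2, x] = [~ y, h1].
  by apply: Zuniq => //; [apply: FZ | rewrite -invg_comm groupV FZ].
have memJ m : m \in M2 -> m ^ x \in M2.
  by move=> Mm; rewrite memJ_norm // (subsetP (normal_norm nMG)).
have yxh : y ^ (x * h1) = y ^ x * [~ h2, x].
  rewrite conjgM conjg_mulR z12; congr (_ * _).
  have {1}<- : h1 ^ x = h1 by apply/conjg_fixP/commgP/commute_sym.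
  by rewrite -conjRg Zfix // -invg_comm groupV FZ.
have [|||||||g Gg [fg xg]] :=
    @inner_ext _ G M2 2 p_pr innG nMG iMG sZM2 x h1 Gx M2'x (sFM2' _ Fh1) f => //.
- by move=> m Mm; rewrite groupM // sFM2' // Fchi.
- move=> m Mm; have Fcm := Fchi m Mm; rewrite /f /= (chiM _ _ Mm (sFM2' _ Fcm)).
  by rewrite (chiF _ Fcm) mulg1 -mulgA -[chi m * chi m]/(chi m ^+ 2) F2 ?mulg1.
- by move=> z Zz; rewrite /f chiF ?mulg1 // (subsetP sZF).
- apply: (eq_morphism_prime_index p_pr nFM iFM M2y F'y).
  + by move=> a b Ma Mb; rewrite conjMg fM ?memJ.
  + by move=> a b Ma Mb; rewrite fM // conjMg.
  + by move=> a Fa; rewrite /f !chiF ?FJ // !mulg1 conjgM (Ffix (FJ Fa Gx) Fh1).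
  have Fyx := commF Gy Gx.
  rewrite /= /f chiy conjMg yxh {2}(conjg_mulR y x) (chiM _ _ M2y (sFM2' _ Fyx)) chiy (chiF _ Fyx) mulg1.
  rewrite conjgM (Ffix (FJ Fh2 Gx) Fh1) (conjg_mulR h2 x) -(mulgA (y ^ x)).
  have Zz := FZ Fh2 Gx; have chz := mem_center_comm Zz Gh2.
  rewrite -[h2 in LHS](mulg1 h2) -(ZZ Zz) expgS expg1.
  by rewrite (mulgA h2) [in LHS]chz -(mulgA _ h2).
- rewrite /f chiF ?sqrF // mulg1 expgMn //.
  by rewrite (F2 h1) // mulg1.
- by rewrite !big_ord_recl big_ord0 mulg1 /= /f chiF // mulg1 -[h1 * h1]/(h1 ^+ 2) F2.
have Fg : g \in F.
  rewrite -cF inE Gg; apply/centP=> a Fa; apply/commute_sym/commgP/conjg_fixP.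
  by rewrite -fg ?sFM2' // /f chiF ?mulg1.
case/negP: Z'h1; have -> : h1 = [~ x, g] by rewrite commgEl -xg mulKg.
by rewrite -invg_comm groupV FZ.
Qed.

(** Let M be the centralizer of v and y in M outside F = 'Z_2(G), and let N be
    the centralizer of y in F, which is <[v]> 'Z(G). If some x outside M has a
    central square, [two_step_twist] applies unless G / N is abelian; but then
    G / N is generated by two commuting involutions although its order is 8.
    If there is no such x and F is not elementary, then w = x ^+ 2 has order
    4, d = [~ y, x] is in N but not central, and y ^+ 2 is central. In this
    case the automorphism is conjugation by x * y on F, fixes y and sends x
    to x ^+ 3 = x * w; it is not inner since w is not in N, which contains the
    commutators. *)
Lemma order32_invol_absurd v :
  v \in F -> v \notin 'Z(G) -> v ^+ 2 = 1 -> {in F, forall u, u ^+ 2 = 1}.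
Proof.
move=> Fv Z'v v2; have sFG' := subsetP sFG; have Gv := sFG' v Fv.
have nZG := center_normal G.
have oF : #|F| = 8 by rewrite (card_ucn p_pr pG nabG innG oG c_gt2) // clG.
have maxM := cent1_maximal p_pr pG nabG innG oG c_gt2 Fv Z'v.
have sZM := center_sub_cent1 Gv; set M := 'C_G[v] in maxM sZM.
have nMG := p_maximal_normal pG maxM; have iMG := p_maximal_index pG maxM.
have sMG := normal_sub nMG; have sMG' := subsetP sMG.
have sFM2 := sFM maxM sZM; have sFM2' := subsetP sFM2.
have nFM := normalS sFM2 sMG nFG; have iFM := iMF maxM sZM.
have [y My F'y] : exists2 y, y \in M & y \notin F :=
  prime_index_witness p_pr iFM.
have Gy := sMG' y My.
have genG (H : {group gT}) x : F \subset H -> y \in H -> x \in H ->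
    x \in G -> x \notin M -> G \subset H.
  move=> sFH Hy Hx Gx M'x; apply: (mem_prime_index_gen p_pr nMG iMG Gx M'x _ Hx).
  exact: (mem_prime_index_gen p_pr nFM iFM My F'y sFH Hy).
(* the centralizer of y in 'Z_2(G) is <[v]> 'Z(G) *)
pose N := 'C_F[y]%G.
have sNF : N \subset F := subsetIl _ _; have sNF' := subsetP sNF.
have sZN : 'Z(G) \subset N.
  rewrite subsetI sZF; apply/subsetP=> z Zz; apply/cent1P/commute_sym.
  exact: (mem_center_comm Zz).
have sZN' := subsetP sZN.
have Nv : v \in N by rewrite inE Fv; have /setIP[_] := My; rewrite cent1C.
have iFN : #|F : N| = 2.
  have oZ : #|'Z(G)| = 2 := card_center p_pr pG nabG innG oG c_gt2.
  apply: (index_cent1_prime p_pr (pgroupS sFG pG) oZ).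
    apply: contra F'y => sFC; rewrite -cF inE Gy; apply/centP=> a Fa.
    exact/esym/cent1P/(subsetP sFC).
  by move=> a Fa; rewrite -invg_comm groupV FZ.
have nNG : N <| G.
  rewrite /normal (subset_trans sNF sFG); apply/subsetP=> a Ga; rewrite inE.
  apply/subsetP=> _ /imsetP[b Nb ->]; rewrite conjg_mulR groupM // sZN' // FZ //.
  exact: sNF'.
have nNF := normalS sNF sFG nNG.
have sFGN : {in F & G, forall a b, [~ a, b] \in N}.
  by move=> a b Fa Gb; apply/sZN'/FZ.
have Ny2 : y ^+ 2 \in N.
  by rewrite inE sqrF //=; apply/cent1P/commute_sym/commuteX.
have cMv : v \in 'C(M) by apply/centP=> a /setIP[_ /cent1P].
have F'M x : x \in G -> x \notin M -> [~ v, x] != 1.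
  by move=> Gx; apply: contra => /commgP cvx; rewrite inE Gx; apply/cent1P.
have commN x : x \in G -> x \notin M -> [~ y, x] \in N ->
    {in G &, forall a b, [~ a, b] \in N}.
  move=> Gx M'x Nyx.
  have modN a : a \in G -> [~ a, y] \in N -> [~ a, x] \in N ->
      {in G, forall b, [~ a, b] \in N}.
    move=> Ga Nay Nax b Gb.
    suff: b \in cent1_mod G N a by rewrite mem_cent1_mod // => /andP[].
    apply: subsetP b Gb; apply: (genG _ x _ _ _ Gx M'x).
    - apply/subsetP=> b Fb; rewrite mem_cent1_mod // sFG' //=.
      by rewrite -invg_comm groupV sFGN.
    - by rewrite mem_cent1_mod // Gy.
    - by rewrite mem_cent1_mod // Gx.
  have Ny : {in G, forall b, [~ y, b] \in N} by apply: modN; rewrite // commgg group1.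
  have Nx : {in G, forall b, [~ x, b] \in N}.
    by apply: modN; rewrite // ?commgg ?group1 // -invg_comm groupV.
  by move=> a b Ga; apply: modN; rewrite // -invg_comm groupV ?Ny ?Nx.
have Z'sqr x : x \in G -> x \notin M -> x ^+ 2 \notin 'Z(G).
  move=> Gx M'x; apply/negP=> Zx2.
  have Nyx : [~ y, x] \in N.
    apply: contraT => N'yx; have Zvx := FZ Fv Gx.
    have [h [Gh cxh cNh yh dh]] := two_step_twist p_pr innG nMG nFG nNG iMG iFM iFN
      sFM2 sNF sZN sFGN Nv cMv v2 Gx M'x My F'y (sZN' _ Zx2) Ny2 Zvx (ZZ Zvx)
      (commF Gy Gx) N'yx.
    have F'h : h \notin F.
      apply: contra (F'M x Gx M'x) => Fh; rewrite -dh; apply/commgP.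
      exact: abF (commF Gy Gx) Fh.
    have Mh : h \in M by rewrite inE Gh; apply/cent1P/(centP cNh).
    have [i [a Fa def_y]] := prime_index_decomp p_pr nFM iFM Mh F'h My.
    case/negP: N'yx; rewrite def_y commMgJ (eqP (introT commgP (commute_sym (commuteX i cxh)))).
    by rewrite conj1g mul1g; apply: sFGN.
  have comN := commN x Gx M'x Nyx; have nNG' := normal_norm nNG.
  pose H := (<[x]> <*> <[y]> <*> N)%G.
  have sHG : H \subset G by rewrite !join_subG !cycle_subG Gx Gy normal_sub.
  (* a maximal subgroup containing H would contain F, hence be all of G *)
  have defH : H :=: G.
    have [// | [Mx maxMx]] := maximal_exists sHG.
    rewrite !join_subG !cycle_subG => /andP[/andP[Mxx Mxy] sNMx].
    have sFMx := sFM maxMx (subset_trans sZN sNMx).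
    have := maxgroupp maxMx; rewrite properE.
    by rewrite (genG Mx x sFMx Mxy Mxx Gx M'x) andbF.
  have [Nx Ny] := (subsetP nNG' x Gx, subsetP nNG' y Gy).
  have ox a : a \in 'N(N) -> a ^+ 2 \in N -> #|<[coset N a]>| <= 2.
    move=> Na Na2; rewrite -orderE; apply: dvdn_leq => //.
    by rewrite order_dvdn -morphX //= coset_id.
  have oGN : #|G / N| = 8.
    rewrite card_quotient // -(Lagrange_index sFG sNF) iFN.
    by have := index_ucn_pred p_pr pG nabG innG oG c_gt2; rewrite clG /= => ->.
  have : #|G / N| <= 4.
    rewrite -{1}defH /= quotientYidr ?join_subG ?cycle_subG ?Nx //.
    rewrite quotientY ?cycle_subG // !quotient_cycle //.
    rewrite cent_joinEl; last first.
      rewrite cycle_subG; apply/centP=> _ /cycleP[i ->]; apply: commuteX.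
      by apply/commgP; rewrite -morphR //= coset_id // comN.
    have := mul_cardG <[coset N x]> <[coset N y]>.
    have := leq_mul (ox x Nx (sZN' _ Zx2)) (ox y Ny Ny2).
    move=> le4 eq; apply: leq_trans le4; rewrite eq leq_pmulr // cardG_gt0.
  by rewrite oGN.
case/properP: (maxgroupp maxM) => _ [x Gx M'x].
have centZ a : a \in F -> commute a x -> commute a y -> a \in 'Z(G).
  move=> Fa cax cay; apply/centerP; split=> [|b Gb]; first exact: sFG'.
  apply/cent1P; rewrite cent1C; apply: subsetP b Gb.
  apply: (genG _ x _ _ _ Gx M'x).
  - by apply/subsetP=> b Fb; apply/cent1P/abF.
  - exact/cent1P/commute_sym.
  - exact/cent1P/commute_sym.
pose w := x ^+ 2; have Fw : w \in F := sqrF Gx; have Gw := sFG' w Fw.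
have Z'w : w \notin 'Z(G) := Z'sqr x Gx M'x.
have cxw : commute x w := commuteX 2 (commute_refl x).
have N'w : w \notin N.
  apply: contra Z'w => /setIP[_ /cent1P cwy].
  exact: centZ _ Fw (commute_sym cxw) cwy.
have nZN := normalS sZN (normal_sub nNG) nZG.
(* N = <[v]> 'Z(G) is elementary, so if F is not, then w has order 4 *)
have iNZ : #|N : 'Z(G)| = 2.
  have := Lagrange_index sNF sZN; rewrite iFN -(divgS sZF) oF.
  rewrite (card_center p_pr pG nabG innG oG c_gt2) => eq4.
  by apply/eqP; rewrite -(eqn_pmul2l (isT : 0 < 2)) eq4.
have N2 n : n \in N -> n ^+ 2 = 1.
  case/(prime_index_decomp p_pr nZN iNZ Nv Z'v)=> i [z0 Zz0 ->].
  have cvz := mem_center_comm Zz0 (groupX i Gv).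
  by rewrite (expgMn 2 cvz) (ZZ Zz0) mulg1 -expgM mulnC expgM v2 expg1n.
have [w2 | w2] := eqVneq (w ^+ 2) 1.
  move=> u /(prime_index_decomp p_pr nNF iFN Fw N'w)[i [n Nn ->]].
  have cwn := abF (groupX i Fw) (sNF' n Nn).
  by rewrite (expgMn 2 cwn) (N2 n) // mulg1 -expgM mulnC expgM w2 expg1n.
suff: False by [].
pose z := [~ v, x]; have Zz : z \in 'Z(G) := FZ Fv Gx; have nz : z != 1 := F'M x Gx M'x.
have zE a b : a \in F -> b \in G -> ~ commute a b -> [~ a, b] = z.
  move=> Fa Gb nab; apply: Zuniq => //; first exact: FZ.
  by apply/commgP.
have wz : w ^+ 2 = z.
  by apply: Zuniq => //; apply: (ucn2_expgp p_pr pG nabG innG oG c_gt2).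
pose d := [~ y, x]; have Fd : d \in F := commF Gy Gx.
have Gxy : x * y \in G by rewrite groupM.
have M'xy : x * y \notin M by rewrite groupMr.
pose w1 := (x * y) ^+ 2; have Fw1 : w1 \in F := sqrF Gxy.
have cw1 : commute w1 (x * y) := commute_sym (commuteX 2 (commute_refl _)).
have Z'w1 : w1 \notin 'Z(G) := Z'sqr _ Gxy M'xy.
have cxxy a : commute a (x * y) -> commute a y -> commute a x.
  move=> caxy cay; rewrite -(mulgK y x); apply: commuteM caxy _.
  exact: commuteV.
have N'w1 : w1 \notin N.
  apply: contra Z'w1 => /setIP[_ /cent1P cw1y].
  exact: centZ _ Fw1 (cxxy _ cw1 cw1y) cw1y.
have def_w1 : w1 = w * (y ^+ 2 * d ^ y).
  rewrite /w1 /w !expgS !expg0 !mulg1 -!mulgA; congr (_ * _).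
  rewrite [LHS]mulgA (conjgC y x) -mulgA; congr (_ * _).
  by rewrite (conjg_mulR y x) -/d -(mulgA y d) (conjgC d y).
have Nd : d \in N.
  have Ndy : d ^ y \in N.
    have: y ^+ 2 * d ^ y \in N; last by rewrite groupMl.
    have Nw2 : w ^+ 2 \in N by rewrite wz; apply: sZN'.
    rewrite -(groupMl _ Nw2) expgS expg1 -mulgA -def_w1.
    exact: mulg_index2 nNF iFN Fw Fw1 N'w N'w1.
  by rewrite -(conjgK y d) memJ_norm // groupV (subsetP (normal_norm nNG)).
have cdy : commute d y by have /setIP[_ /cent1P] := Nd.
have Z'd : d \notin 'Z(G).
  apply: contra F'y => Zd; apply/mem_ucn2; split=> // b Gb.
  suff: b \in cent1_mod G 'Z(G) y by rewrite mem_cent1_mod // => /andP[].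
  apply: subsetP b Gb; apply: (genG _ x _ _ _ Gx M'x).
  - apply/subsetP=> b Fb; rewrite mem_cent1_mod // sFG' //=.
    by rewrite -invg_comm groupV FZ.
  - by rewrite mem_cent1_mod // Gy commgg group1.
  - by rewrite mem_cent1_mod // Gx.
have dx : d ^ x = d * z.
  rewrite conjg_mulR (zE d x Fd Gx) // => cdx.
  by case/negP: Z'd; apply: centZ.
have wy : w ^ y = w * z.
  rewrite conjg_mulR (zE w y Fw Gy) // => cwy.
  by case/negP: Z'w; apply: centZ (commute_sym cxw) cwy.
(* otherwise y ^+ 2 * d is central, and w1 = w * (y ^+ 2 * d) commutes with x
   and with x * y, hence with y *)
have Zy2 : y ^+ 2 \in 'Z(G).
  apply: contraT => Z'y2; case/negP: N'w1; rewrite inE Fw1; apply/cent1P.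
  have Zy2d := mulg_index2 nZN iNZ Ny2 Nd Z'y2 Z'd.
  have cw1x : commute w1 x.
    rewrite def_w1 (conjg_fixP (introT commgP cdy)); apply: commute_sym.
    by apply: commuteM cxw _; apply: (mem_center_comm Zy2d).
  rewrite -(mulKg x y); apply: commuteM _ cw1; exact: commuteV.
have comN := commN x Gx M'x Nd.
have actC a : a \in F -> a ^ (y * x) = a ^ (x * y).
  move=> Fa; rewrite (commgC x y) [RHS]conjgM; symmetry; apply: Ffix.
    by apply: FJ; rewrite ?groupM.
  exact: commF.
have [f [fM fF fy]] : exists F0 : gT -> gT,
    [/\ {in M &, {morph F0 : a b / a * b}}, {in F, F0 =1 conjg^~ (x * y)} & F0 y = y].
  apply: (ext_morphism_prime_index p_pr nFM iFM My F'y).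
  - by move=> a b _ _; rewrite conjMg.
  - by move=> a Fa; rewrite /= -[LHS]conjgM mulgA [LHS]conjgM actC.
  - by rewrite Zfix.
have decM := prime_index_decomp p_pr nFM iFM My F'y.
have fX i : f (y ^+ i) = y ^+ i.
  elim: i => [|i IHi]; first by rewrite !expg0 fF ?group1 // conj1g.
  by rewrite !expgS (fM _ _ My (groupX i My)) fy IHi.
have fin m : m \in M -> f m \in M.
  case/decM=> i [a Fa ->]; rewrite (fM _ _ (groupX i My) (sFM2' a Fa)) fX fF //.
  by rewrite groupM ?groupX // sFM2' // FJ.
have memJ m : m \in M -> m ^ x \in M.
  by move=> Mm; rewrite memJ_norm // (subsetP (normal_norm nMG)).
have eqM := eq_morphism_prime_index p_pr nFM iFM My F'y.
have wx : w ^ x = w by apply/conjg_fixP/commgP/commute_sym.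
have fw : f w = w * z by rewrite fF // conjgM wx wy.
have zz : z * z = 1 := ZZ Zz.
have [|||||||g Gg [_ xg]] :=
    @inner_ext _ G M 2 p_pr innG nMG iMG sZM x w Gx M'x (sFM2' w Fw) f => //.
- apply: eqM => //.
  + by move=> a b Ma Mb; rewrite /= (fM a b) // fM ?fin.
  + move=> a Fa; rewrite /= (fF a Fa) (fF _ (FJ Fa Gxy)) -conjgM.
    exact: Ffix Fa Fw1.
  by rewrite /= !fy.
- by move=> z0 Zz0; rewrite fF ?Zfix // (subsetP sZF).
- apply: eqM.
  + by move=> a b Ma Mb; rewrite conjMg fM ?memJ.
  + by move=> a b Ma Mb; rewrite fM // conjMg.
  + move=> a Fa; have Fax := FJ Fa Gx.
    rewrite /= !fF // -conjgM mulgA [x * x](_ : _ = w) // conjgM (Ffix Fa Fw).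
    rewrite [RHS]conjgM (Ffix _ Fw) ?FJ // -actC // -!conjgM -mulgA.
    by rewrite [x * x](_ : _ = w) // conjgM (Ffix _ Fw) ?FJ.
  have dxy : d ^ (x * y) = d * z.
    by rewrite conjgM dx conjMg (conjg_fixP (introT commgP cdy)) Zfix.
  have yw : y ^ w = y * z.
    rewrite conjg_mulR -invg_comm commgEl wy mulKg; congr (_ * _).
    by apply/eqP; rewrite eq_invg_mul zz.
  rewrite /= fy conjgM (conjg_mulR y x) -/d (fM _ _ My (sFM2' d Fd)) fy fF // dxy.
  rewrite conjMg yw (Ffix Fd Fw) -[RHS]mulgA; congr (_ * _).
  exact: (mem_center_comm Zz (sFG' d Fd)).
- by rewrite -/w fw (expgMn 2 cxw) wz.
- rewrite !big_ord_recl big_ord0 mulg1 /= fw mulgA -[w * w]/(w ^+ 2) wz.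
  exact: zz.
have : w \in N by have -> : w = [~ x, g]; [rewrite commgEl -xg mulKg | apply: comN].
by rewrite (negPf N'w).
Qed.

End Order32.

(** * The theorem *)

Theorem theorem1p2 (gT : finGroupType) (G : {group gT}) (p : nat)
    (p_pr : prime p) (pG : p.-group G) (nabG : ~~ abelian G)
    (coclG : coclass p G = 2) :
  exists a : {perm gT},
    [/\ a \in Aut G, #[a] = p, ~ is_inner G a
      & {in 'Z(G), forall z, a z = z}].
Proof.
have [/existsP[a /and4P[Aa /eqP oa /forall_inP fixZ ninn]] | noA] := boolP
  [exists a : {perm gT}, [&& a \in Aut G, #[a] == p,
    [forall z in 'Z(G), a z == z]
    & ~~ [exists g in G, [forall x in G, a x == x ^ g]]]].
  exists a; split=> // [[g Gg def_a] | z Zz]; last exact/eqP/fixZ.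
  case/negP: ninn; apply/exists_inP; exists g => //.
  by apply/forall_inP=> x Gx; rewrite def_a.
have innG : central_p_auts_inner G p.
  move=> a Aa ap fixZ; have [-> | nt_a] := eqVneq a 1.
    by exists 1 => // x _; rewrite perm1 conjg1.
  have /existsPn/(_ a) := noA.
  rewrite Aa (nt_prime_order p_pr ap nt_a) eqxx /=.
  have -> /= : [forall z in 'Z(G), a z == z] by apply/forall_inP=> z /fixZ->.
  rewrite negbK => /exists_inP[g Gg /forall_inP def_a].
  by exists g => // x Gx; apply/eqP/def_a.
have c_gt1 : 1 < nil_class G by rewrite ltnNge nil_class1.
have oG : logn p #|G| = (nil_class G + 2)%N.
  by rewrite -coclG /coclass subnKC // ltnW // -subn_gt0 -/(coclass p G) coclG.
case: notF; move: c_gt1; rewrite leq_eqVlt => /orP[/eqP/esym c2 | c_gt2].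
  rewrite c2 in oG; have [p2 | p_odd] := even_prime p_pr.
    by rewrite p2 in pG innG oG; case: (order16_absurd pG nabG innG oG c2).
  by case: (odd_class2_absurd p_pr pG nabG innG oG c2 p_odd).
have [p2 | p_odd] := even_prime p_pr; last first.
  by case: (odd_nil_class_gt2_absurd p_pr p_odd pG nabG innG oG c_gt2).
rewrite p2 in pG innG oG; move: (c_gt2); rewrite leq_eqVlt => /orP[/eqP/esym c3 | c_gt3].
  case: (order32_elementary_absurd pG nabG innG oG c3) => u Z2u; apply/eqP.
  apply: contraT => nt_u2.
  have [_ _ [v [Z2v _ Z'v v2]]] := two_ucn2_invol pG nabG innG oG c_gt2 Z2u nt_u2.
  by rewrite (order32_invol_absurd pG nabG innG oG c3 Z2v Z'v v2) ?eqxx in nt_u2.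
by case: (two_large_absurd pG nabG innG oG c_gt3).
Qed.
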